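(* Let $K$ be an infinite field of characteristic different from $2$. Let $B=K\oplus V$ be the Jordan algebra of a nondegenerate symmetric bilinear form on a vector space $V$ over $K$ with $\dim V=\infty$, and let $B_n=K\oplus V_n$ be the Jordan algebra of a nondegenerate symmetric bilinear form on a vector space $V_n$ over $K$ with $\dim V_n=n$, $n\ge 1$. 1. Every weak Jordan identity for the pair $(B,V)$ is a consequence (as a weak identity) of the polynomial $(x_1x_2,x_3,x_4)$. 2. Every weak Jordan identity for the pair $(B_n,V_n)$ is a consequence (as weak identities) of the two polynomials $(x_1x_2,x_3,x_4)$ and $$f_n=\sum_{\sigma\in S_{n+1}}(-1)^\sigma x_{\sigma(1)}(x_{n+2}x_{\sigma(2)})\cdots(x_{2n+1}x_{\sigma(n+1)}).$$
   Context: Given a symmetric bilinear form $\langle\cdot,\cdot\rangle$ on a vector space $V$, the Jordan algebra of the form is $K\oplus V$ with product $(\alpha+u)(\beta+v)=(\alpha\beta+\langle u,v\rangle)+(\alpha v+\beta u)$ for $\alpha,\beta\in K$, $u,v\in V$. $J(X)$ is the free unital Jordan algebra over $K$ on a countably infinite set $X=\{x_1,x_2,\dots\}$. $(a,b,c)=(ab)c-a(bc)$ is the associator. $(-1)^\sigma$ is the sign of $\sigma$. Products of several factors without parentheses are read as left normed. For a Jordan algebra $J$ and a subspace $W$ generating $J$ as an algebra, a polynomial $f(x_1,\dots,x_m)\in J(X)$ is a weak Jordan identity for the pair $(J,W)$ if $f(w_1,\dots,w_m)=0$ for all $w_1,\dots,w_m\in W$. A polynomial is a consequence, as a weak identity,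 of a set $F\subseteq J(X)$ if it lies in the ideal of $J(X)$ generated by all $f(g_1,\dots,g_m)$, where $f=f(x_1,\dots,x_m)\in F$ and $g_1,\dots,g_m$ belong to the $K$-linear span of $X$. *)

(* Defs.v *)
From HB Require Import structures.
From mathcomp Require Import all_boot all_order all_algebra all_fingroup.
From mathcomp Require Import boolp classical_sets functions cardinality.
From mathcomp Require Import sesquilinear generic_quotient.
Set Implicit Arguments.
Unset Strict Implicit.
Unset Printing Implicit Defensive.
Import GRing.Theory.
Local Open Scope ring_scope.
Local Open Scope quotient_scope.

Reserved Notation "x ** y" (at level 40, left associativity).

HB.mixin Record Lmodule_isJordan (K : fieldType) J of GRing.Lmodule K J := {
  jone : J;
  jmul : J -> J -> J;
  jmulDl : forall x y z, jmul (x + y) z = jmul x z + jmul y z;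
  jmulZl : forall (a : K) x y, jmul (a *: x) y = a *: jmul x y;
  jmulC : forall x y, jmul x y = jmul y x;
  jmul1l : forall x, jmul jone x = x;
  jordan_identity : forall x y,
    jmul (jmul (jmul x x) y) x = jmul (jmul x x) (jmul y x)
}.

#[short(type="jordanType")]
HB.structure Definition Jordan (K : fieldType) :=
  {J of Lmodule_isJordan K J & GRing.Lmodule K J}.

Notation "x ** y" := (jmul x y) : ring_scope.

Section JordanTheory.
Variables (K : fieldType) (J : jordanType K).
Implicit Types x y z : J.

Definition jassociator x y z := (x ** y) ** z - x ** (y ** z).

Definition is_subspace (V : lmodType K) (S : set V) :=
  S 0 /\ forall (a : K) u v, S u -> S v -> S (a *: u + v).

Definition lspan (V : lmodType K) (G : set V) : set V :=
  smallest (@is_subspace V) G.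

(* One-sided absorption suffices, the product being commutative. *)
Definition is_ideal (I : set J) :=
  is_subspace I /\ forall x y, I y -> I (x ** y).

Definition ideal_gen (G : set J) : set J := smallest is_ideal G.

Definition is_subalgebra (S : set J) :=
  is_subspace S /\ forall x y, S x -> S y -> S (x ** y).

Definition generates (W : set J) := smallest is_subalgebra W = setT.

End JordanTheory.

(* The free unital Jordan algebra on X = {x_1, x_2, ...}: nonassociative terms
   modulo the least congruence containing the axioms of unital Jordan
   K-algebras.  The index i of JVar stands for the generator x_(i+1). *)
Inductive jterm (K : Type) : Type :=
| JVar of nat
| JZero
| JOne
| JAdd of jterm K & jterm K
| JScale of K & jterm K
| JMul of jterm K & jterm K.
Arguments JVar {K} _.
Arguments JZero {K}.
Arguments JOne {K}.

Inductive jeq (K : fieldType) : jterm K -> jterm K -> Prop :=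
| jeq_refl s : jeq s s
| jeq_sym s t : jeq s t -> jeq t s
| jeq_trans s t u : jeq s t -> jeq t u -> jeq s u
| jeq_add s s' t t' : jeq s s' -> jeq t t' -> jeq (JAdd s t) (JAdd s' t')
| jeq_scale a s s' : jeq s s' -> jeq (JScale a s) (JScale a s')
| jeq_mul s s' t t' : jeq s s' -> jeq t t' -> jeq (JMul s t) (JMul s' t')
| jeq_addA s t u : jeq (JAdd s (JAdd t u)) (JAdd (JAdd s t) u)
| jeq_addC s t : jeq (JAdd s t) (JAdd t s)
| jeq_add0 s : jeq (JAdd JZero s) s
| jeq_addN s : jeq (JAdd (JScale (- 1) s) s) JZero
| jeq_scaleA a b s : jeq (JScale a (JScale b s)) (JScale (a * b) s)
| jeq_scale1 s : jeq (JScale 1 s) s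
| jeq_scaleDr a s t : jeq (JScale a (JAdd s t)) (JAdd (JScale a s) (JScale a t))
| jeq_scaleDl a b s : jeq (JScale (a + b) s) (JAdd (JScale a s) (JScale b s))
| jeq_mulDl s t u : jeq (JMul (JAdd s t) u) (JAdd (JMul s u) (JMul t u))
| jeq_mulZl a s t : jeq (JMul (JScale a s) t) (JScale a (JMul s t))
| jeq_mulC s t : jeq (JMul s t) (JMul t s)
| jeq_mul1 s : jeq (JMul JOne s) s
| jeq_jordan s t :
    jeq (JMul (JMul (JMul s s) t) s) (JMul (JMul s s) (JMul t s)).

HB.instance Definition _ (K : Type) := gen_eqMixin (jterm K).
HB.instance Definition _ (K : Type) := gen_choiceMixin (jterm K).

Section FreeJordan.
Variable K : fieldType.

Definition jeqb (s t : jterm K) : bool := `[< jeq s t >].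

Lemma jeqb_equiv : equiv_class_of jeqb.
Proof.
split.
- by move=> s; apply/asboolP/jeq_refl.
- by move=> s t; apply/asboolP/asboolP => /jeq_sym.
- by move=> t s u /asboolP st /asboolP tu; apply/asboolP/(jeq_trans st tu).
Qed.

Canonical jeqb_rel := EquivRelPack jeqb_equiv.

Definition free_jordan : Type := {eq_quot jeqb_rel}.
HB.instance Definition _ : EqQuotient _ jeqb_rel free_jordan :=
  EqQuotient.on free_jordan.
HB.instance Definition _ := Choice.on free_jordan.

Definition fj_pi (t : jterm K) : free_jordan := \pi_free_jordan t.

Lemma fj_piP s t : fj_pi s = fj_pi t <-> jeq s t.
Proof.
split=> [/eqmodP/asboolP // | st].
by apply/eqmodP/asboolP.
Qed.

Lemma fj_repr_pi s : jeq (repr (fj_pi s)) s.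
Proof. by apply/fj_piP; rewrite /fj_pi reprK. Qed.

Definition fj_zero := fj_pi JZero.
Definition fj_add (x y : free_jordan) := fj_pi (JAdd (repr x) (repr y)).
Definition fj_scale (a : K) (x : free_jordan) := fj_pi (JScale a (repr x)).
Definition fj_opp := fj_scale (- 1).
Definition fj_one := fj_pi JOne.
Definition fj_mul (x y : free_jordan) := fj_pi (JMul (repr x) (repr y)).

Lemma fj_pi_add s t : fj_add (fj_pi s) (fj_pi t) = fj_pi (JAdd s t).
Proof. by apply/fj_piP/jeq_add; apply: fj_repr_pi. Qed.
Lemma fj_pi_scale a s : fj_scale a (fj_pi s) = fj_pi (JScale a s).
Proof. by apply/fj_piP/jeq_scale; apply: fj_repr_pi. Qed.
Lemma fj_pi_mul s t : fj_mul (fj_pi s) (fj_pi t) = fj_pi (JMul s t).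
Proof. by apply/fj_piP/jeq_mul; apply: fj_repr_pi. Qed.

Lemma fj_piE x : x = fj_pi (repr x).
Proof. by rewrite /fj_pi reprK. Qed.

Lemma fj_addA : associative fj_add.
Proof.
move=> x y z; rewrite (fj_piE x) (fj_piE y) (fj_piE z) !fj_pi_add.
exact/fj_piP/jeq_addA.
Qed.
Lemma fj_addC : commutative fj_add.
Proof.
by move=> x y; rewrite (fj_piE x) (fj_piE y) !fj_pi_add; exact/fj_piP/jeq_addC.
Qed.
Lemma fj_add0 : left_id fj_zero fj_add.
Proof. by move=> x; rewrite (fj_piE x) fj_pi_add; exact/fj_piP/jeq_add0. Qed.
Lemma fj_addN : left_inverse fj_zero fj_opp fj_add.
Proof.
by move=> x; rewrite (fj_piE x) /fj_opp fj_pi_scale fj_pi_add;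
  exact/fj_piP/jeq_addN.
Qed.

HB.instance Definition _ :=
  GRing.isZmodule.Build free_jordan fj_addA fj_addC fj_add0 fj_addN.

Lemma fj_scaleA a b x : fj_scale a (fj_scale b x) = fj_scale (a * b) x.
Proof. by rewrite (fj_piE x) !fj_pi_scale; exact/fj_piP/jeq_scaleA. Qed.
Lemma fj_scale1 : left_id 1 fj_scale.
Proof.
by move=> x; rewrite (fj_piE x) fj_pi_scale; exact/fj_piP/jeq_scale1.
Qed.
Lemma fj_scaleDr : right_distributive fj_scale +%R.
Proof.
move=> a x y; rewrite (fj_piE x) (fj_piE y)
  -[_ + _]/(fj_add _ _) -[RHS]/(fj_add _ _).
by rewrite fj_pi_add !fj_pi_scale fj_pi_add; exact/fj_piP/jeq_scaleDr.
Qed.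
Lemma fj_scaleDl x : {morph fj_scale^~ x : a b / a + b}.
Proof.
move=> a b; rewrite (fj_piE x) -[RHS]/(fj_add _ _).
by rewrite !fj_pi_scale fj_pi_add; exact/fj_piP/jeq_scaleDl.
Qed.

HB.instance Definition _ :=
  GRing.Zmodule_isLmodule.Build K free_jordan
    fj_scaleA fj_scale1 fj_scaleDr fj_scaleDl.

Lemma fj_mulDl x y z : fj_mul (x + y) z = fj_mul x z + fj_mul y z.
Proof.
rewrite (fj_piE x) (fj_piE y) (fj_piE z)
  -[_ + _]/(fj_add _ _) -[RHS]/(fj_add _ _).
by rewrite fj_pi_add !fj_pi_mul fj_pi_add; exact/fj_piP/jeq_mulDl.
Qed.
Lemma fj_mulZl (a : K) x y : fj_mul (a *: x) y = a *: fj_mul x y.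
Proof.
rewrite (fj_piE x) (fj_piE y) -[_ *: _]/(fj_scale _ _) -[RHS]/(fj_scale _ _).
by rewrite fj_pi_scale !fj_pi_mul fj_pi_scale; exact/fj_piP/jeq_mulZl.
Qed.
Lemma fj_mulC x y : fj_mul x y = fj_mul y x.
Proof. by rewrite (fj_piE x) (fj_piE y) !fj_pi_mul; exact/fj_piP/jeq_mulC. Qed.
Lemma fj_mul1 x : fj_mul fj_one x = x.
Proof. by rewrite (fj_piE x) fj_pi_mul; exact/fj_piP/jeq_mul1. Qed.
Lemma fj_mulJ x y :
  fj_mul (fj_mul (fj_mul x x) y) x = fj_mul (fj_mul x x) (fj_mul y x).
Proof.
by rewrite (fj_piE x) (fj_piE y) !fj_pi_mul; exact/fj_piP/jeq_jordan.
Qed.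

HB.instance Definition _ :=
  Lmodule_isJordan.Build K free_jordan
    fj_mulDl fj_mulZl fj_mulC fj_mul1 fj_mulJ.

Definition jvar (i : nat) : free_jordan := fj_pi (JVar i).

Section Eval.
Variables (J : jordanType K) (w : nat -> J).

Fixpoint jterm_eval (t : jterm K) : J :=
  match t with
  | JVar i => w i
  | JZero => 0
  | JOne => jone
  | JAdd s t => jterm_eval s + jterm_eval t
  | JScale a s => a *: jterm_eval s
  | JMul s t => jterm_eval s ** jterm_eval t
  end.

(* f(w_1, w_2, ...), with w_i the value of w at i - 1; it is independent of the
   representative by jterm_eval_jeq, and is the unique unital homomorphism
   extending w by jeval_unique. *)
Definition jeval (f : free_jordan) : J := jterm_eval (repr f).

Lemma jterm_eval_jeq s t : jeq s t -> jterm_eval s = jterm_eval t.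
Proof.
elim=> {s t} //=; try by move=> *; congruence.
- by move=> s t u; rewrite addrA.
- by move=> s t; rewrite addrC.
- by move=> s; rewrite add0r.
- by move=> s; rewrite scaleN1r addNr.
- by move=> a b s; rewrite scalerA.
- by move=> s; rewrite scale1r.
- by move=> a s t; rewrite scalerDr.
- by move=> a b s; rewrite scalerDl.
- by move=> s t u; rewrite jmulDl.
- by move=> a s t; rewrite jmulZl.
- by move=> s t; rewrite jmulC.
- by move=> s; rewrite jmul1l.
- by move=> s t; rewrite jordan_identity.
Qed.

Lemma jeval_pi t : jeval (fj_pi t) = jterm_eval t.
Proof. exact/jterm_eval_jeq/fj_repr_pi. Qed.

Lemma jeval_var i : jeval (jvar i) = w i.
Proof. exact: jeval_pi. Qed.

Lemma jeval_one : jeval jone = jone.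
Proof. exact: jeval_pi. Qed.

Lemma jevalD f g : jeval (f + g) = jeval f + jeval g.
Proof. exact: jeval_pi. Qed.

Lemma jevalZ a f : jeval (a *: f) = a *: jeval f.
Proof. exact: jeval_pi. Qed.

Lemma jevalM f g : jeval (f ** g) = jeval f ** jeval g.
Proof. exact: jeval_pi. Qed.

Lemma jeval_unique (h : free_jordan -> J) :
  (forall i, h (jvar i) = w i) -> h jone = jone ->
  (forall f g, h (f + g) = h f + h g) ->
  (forall a f, h (a *: f) = a *: h f) ->
  (forall f g, h (f ** g) = h f ** h g) ->
  h =1 jeval.
Proof.
move=> hv h1 hD hZ hM f; rewrite (fj_piE f) jeval_pi.
elim: (repr f) => [i|||s IHs t IHt|a s IHs|s IHs t IHt] /=.
- exact: hv.
- by have := hZ 0 0; rewrite !scale0r => <-.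
- exact: h1.
- by rewrite -fj_pi_add (hD (fj_pi s) (fj_pi t)) IHs IHt.
- by rewrite -fj_pi_scale (hZ a (fj_pi s)) IHs.
- by rewrite -fj_pi_mul (hM (fj_pi s) (fj_pi t)) IHs IHt.
Qed.

End Eval.

(* Meant for W a subspace generating J, which vec_subspace and vec_generates
   establish for V inside K + V. *)
Definition weak_identity (J : jordanType K) (W : set J) (f : free_jordan) :=
  forall w : nat -> J, (forall i, W (w i)) -> jeval w f = 0.

Definition Xspan : set free_jordan := lspan (range jvar).

Definition weak_consequence (F : set free_jordan) : set free_jordan :=
  ideal_gen [set h | exists f (g : nat -> free_jordan),
                       [/\ F f, forall i, Xspan (g i) & h = jeval g f]].

Definition assoc_poly : free_jordan :=
  jassociator (jvar 0 ** jvar 1) (jvar 2) (jvar 3).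

(* f_n, with sigma acting on 'I_n.+1 = {0, ..., n}: the left-normed product of
   x_(sigma(1)) and the factors x_(n+2+k) x_(sigma(k+2)) for k = 0, ..., n-1. *)
Definition alt_poly (n : nat) : free_jordan :=
  \sum_(sigma : 'S_n.+1) (-1) ^+ sigma *:
    foldl (fun p (k : 'I_n) =>
             p ** (jvar (n.+1 + k) ** jvar (sigma (lift ord0 k))))
          (jvar (sigma ord0)) (enum 'I_n).

End FreeJordan.
Arguments jvar {K} i.

Section FormAlgebra.
Variables (K : fieldType) (V : lmodType K).

Definition nondegenerate_form (form : {symmetric V}) :=
  forall u : V, (forall v, form u v = 0) -> u = 0.

(* The underlying space is K + V; the form only determines the product. *)
Definition form_algebra of {symmetric V} : Type := (K^o * V)%type.

Variable form : {symmetric V}.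
Local Notation B := (form_algebra form).

HB.instance Definition _ := GRing.Lmodule.copy B (K^o * V)%type.

Definition form_one : B := (1, 0).
Definition form_mul (x y : B) : B :=
  let: (alpha, u) := (x.1 : K, x.2) in
  let: (beta, v) := (y.1 : K, y.2) in
  (alpha * beta + form u v, alpha *: v + beta *: u).

Local Notation one := form_one.
Local Notation mul := form_mul.

Lemma form_sym u v : form u v = form v u.
Proof. by rewrite hermC expr0 mul1r. Qed.

Lemma form_mulDl x y z : mul (x + y) z = mul x z + mul y z.
Proof.
rewrite /form_mul /= [RHS]/GRing.add /= /add_pair /=; congr pair.
  by rewrite linearDl mulrDl addrACA.
by rewrite scalerDl scalerDr addrACA.
Qed.
Lemma form_mulZl (a : K) x y : mul (a *: x) y = a *: mul x y.
Proof.
rewrite /form_mul /= [RHS]/GRing.scale /= /scale_pair /=; congr pair.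
  by rewrite linearZl_LR /GRing.scale /= mulrDr mulrA.
by rewrite scalerDr !scalerA [y.1 * a]mulrC.
Qed.
Lemma form_mulC x y : mul x y = mul y x.
Proof.
by rewrite /form_mul form_sym mulrC addrC [X in (_, X)]addrC [X in (X, _)]addrC.
Qed.
Lemma form_mul1 x : mul one x = x.
Proof.
case: x => a u.
by rewrite /form_mul /= linear0l mul1r addr0 scale1r scaler0 addr0.
Qed.
Lemma form_mulJ x y : mul (mul (mul x x) y) x = mul (mul x x) (mul y x).
Proof.
pose a : K := x.1; pose c : K := form x.2 x.2 - a * a.
have sqE : mul x x = (a + a) *: x + c *: one.
  rewrite /form_mul [RHS]/GRing.add /= /add_pair /=; congr pair.
    by rewrite /GRing.scale /= mulr1 mulrDl /c addrACA subrr addr0.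
  by rewrite scaler0 addr0 scalerDl.
rewrite sqE !form_mulDl !form_mulZl !form_mul1.
by congr (_ *: _ + _); rewrite form_mulC [mul y x]form_mulC.
Qed.

HB.instance Definition _ :=
  Lmodule_isJordan.Build K B
    form_mulDl form_mulZl form_mulC form_mul1 form_mulJ.

Definition vec (u : V) : B := (0, u).

Lemma vec_subspace : is_subspace (range vec).
Proof.
split; first by exists 0.
move=> a _ _ [u _ <-] [v _ <-]; exists (a *: u + v) => //.
change ((0, a *: u + v) = (a * 0 + 0, a *: u + v)).
by rewrite mulr0 addr0.
Qed.

Lemma vec_generates :
  nondegenerate_form form -> (exists u : V, u != 0) -> generates (range vec).
Proof.
move=> nd [u u0]; apply/seteqP; split=> // x _ S [[[S0 SP] SM] SV].
have [v uv0] : exists v, form u v != 0.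
  apply: contrapT => h; case/eqP: u0; apply: nd => v.
  by apply/eqP; apply: contrapT => /negP uv; apply: h; exists v.
have Sv v' : S (vec v') by apply: SV; exists v'.
have := SM _ _ (Sv u) (Sv v) => Suv.
have := SP ((x.1 : K) / form u v) _ _ Suv (Sv x.2); congr S.
case: x {Suv} => a w.
have -> : vec u ** vec v = (form u v, 0).
  by rewrite /jmul /= /form_mul /= mul0r add0r !scale0r addr0.
change ((a / form u v * form u v + 0, (a / form u v) *: (0 : V) + w) = (a, w)).
by rewrite divfK // addr0 scaler0 add0r.
Qed.

End FormAlgebra.

Definition infinite_dim (K : fieldType) (V : lmodType K) :=
  forall s : seq V, lspan [set v | v \in s] <> setT.

(* Main.v *)
From HB Require Import structures.
Require Import Defs.
From mathcomp Require Import all_boot all_order all_algebra all_fingroup.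
From mathcomp Require Import boolp classical_sets functions cardinality.
From mathcomp Require Import sesquilinear zify.
Import GRing.Theory.
Local Open Scope ring_scope.
Local Open Scope classical_set_scope.
Set Implicit Arguments.
Unset Strict Implicit.
Unset Printing Implicit Defensive.

(** Let [I] be the ideal of weak consequences. The proof computes [J(X)/I].

    Structure of [J(X)/I]. In a Jordan algebra every commutator [L_a, L_b] of
    multiplications is a derivation ([inner_derivation]). Modulo [I] the
    derivation [L_{xy}, L_z], for generators x, y, z, kills the generators,
    because its values on them are the associators (xy, t, z); hence it vanishes
    ([pairing_letter], [pairing_comm]): multiplications by products of two
    generators commute with each other and with multiplications by generators.
    As the operators L_x and L_{xy} generate the whole multiplication algebra
    ([jmul_composite]), [J(X)/I] is spanned by the products
    (x_i x_j)(x_k x_l)... and their multiples by one generator.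
    With a formal letter 0, sent to the unit of [J(X)] and standing for
    an auxiliary vector, both sorts become lists of pairs of letters: multigraphs
    in which the letter 0 is used at most once. On vectors such a
    monomial takes the value of the product of the scalar products along its edges.

    What remains is the second fundamental theorem for the orthogonal group, in
    every characteristic other than 2: a polynomial in the scalar products that
    vanishes on an n-dimensional space lies in the ideal of the minors of size
    n+1. These minors are the consequences of [f_n] ([minor_relation]).
    Order the edges (i, j), i <= j, by strict inequality in both coordinates, and
    give a monomial the weight \sum i * j. By the rearrangement inequality the
    diagonal term is the unique heaviest term of a minor, so a monomial
    containing a chain of n+1 edges can be rewritten by strictly lighter ones
    ([mono_span_coverable]). If no such chain exists, the edges can be coloured
    with n colours, each colour class being an antichain
    ([coverable_or_chain]), that is, a nest of intervals.

    Such reduced monomials are linearly independent as functions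
    ([standard_monomials_independent]): evaluate at v_i = \sum_k t_{ik} e_k for
    an orthogonal anisotropic family e_1, ..., e_n, and expand
    <v_i, v_j> = \sum_k <e_k, e_k> t_{ik} t_{jk}, so that a term of the expansion
    is an edge colouring. A nest of intervals is the unique lightest
    multigraph with its degree sequence ([nested_minimal]). Hence, if s is the
    heaviest monomial in a relation, the monomial in the t_{ik} read off from its
    antichain colouring comes from s alone, and from no other colouring of s.
    As K is infinite its coefficient is zero.

    In infinite dimension no minors are needed: take n larger
    than the degree, so that the edges can be given distinct colours. *)

(** * Jordan algebras of characteristic not 2 *)

Lemma lmod_double_eq0 (K : fieldType) (V : lmodType K) (x : V) :
  2%N \notin [pchar K] -> x + x = 0 -> x = 0.
Proof.
rewrite inE /= => two0 xx; have := congr1 (fun y => (2%:R : K)^-1 *: y) xx.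
by rewrite /= scaler0 -mulr2n -scaler_nat scalerA mulVf // scale1r.
Qed.

Section Jordan.
Variables (K : fieldType) (J : jordanType K).
Implicit Types a b c x y z : J.

Lemma jmul_is_linear x : linear (jmul x).
Proof. by move=> k y z; rewrite !(jmulC x) jmulDl jmulZl. Qed.

HB.instance Definition _ x := GRing.isLinear.Build K J J *:%R (jmul x) (jmul_is_linear x).

Lemma jmulDr x y z : x ** (y + z) = x ** y + x ** z.
Proof. exact: linearD. Qed.
Lemma jmulBr x y z : x ** (y - z) = x ** y - x ** z.
Proof. exact: linearB. Qed.
Lemma jmulBl x y z : (x - y) ** z = x ** z - y ** z.
Proof. by rewrite jmulC jmulBr !(jmulC z). Qed.
Lemma jmulZr (k : K) x y : x ** (k *: y) = k *: (x ** y).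
Proof. exact: linearZ. Qed.
Lemma jmul0r x : x ** 0 = 0.
Proof. exact: linear0. Qed.
Lemma jmul1r x : x ** jone = x.
Proof. by rewrite jmulC jmul1l. Qed.

Hypothesis char2 : 2%N \notin [pchar K].

(** The full polarization of the cubic map T a a a is twice the cyclic sum, by
    the symmetry of T in its first two arguments; this is why only the
    characteristic 2 is excluded. *)
Lemma polarization (T : J -> J -> J -> J) :
  (forall b c, {morph (fun a => T a b c) : x y / x + y}) ->
  (forall a c, {morph T a ^~ c : x y / x + y}) ->
  (forall a b, {morph T a b : x y / x + y}) ->
  (forall a b c, T a b c = T b a c) ->
  (forall a, T a a a = 0) ->
  forall a b c, T a b c + T b c a + T c a b = 0.
Proof.
move=> D1 D2 D3 sym T0.
(* N a b is the part of T at (a + b) that is quadratic in a and linear in b. *)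
pose N a b := T a a b + (T a b a + T b a a).
have N0 a b : N a b + N b a = 0.
  rewrite -[RHS](T0 (a + b)) !(D1, D2, D3) !T0 add0r addr0.
  by rewrite [RHS](AC ((1*2)*3) ((1*(2*4))*(6*(5*3)))).
have NN a b : N a b = - N b a by apply/eqP; rewrite -addr_eq0 N0.
have ND a a' b : N (a + a') b = N a b + N a' b.
  rewrite NN (NN a) (NN a') -opprD; congr (- _).
  by rewrite /N !(D1, D2, D3) [LHS](AC (2*(2*2)) ((1*(3*5))*(2*(4*6)))).
move=> a b c; apply: (lmod_double_eq0 char2).
rewrite -[RHS](subrr (N (a + c) b)) [X in _ = _ - X]ND.
rewrite /N !(D1, D2, D3) !(sym c) !(sym b a) !(sym b c).
apply/esym/eqP; rewrite subr_eq; apply/eqP.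
by rewrite [LHS](AC ((2*2)*((2*2)*(2*2)))
  (((6*7*2)*(10*11*3))*((1*(5*9))*(4*(8*12))))).
Qed.

(** Polarization of the Jordan identity (x x, y, x) = 0 in x. *)
Lemma jordan_linearized a b c y :
  ((a ** b) ** y) ** c + ((b ** c) ** y) ** a + ((c ** a) ** y) ** b
  = (a ** b) ** (y ** c) + (b ** c) ** (y ** a) + (c ** a) ** (y ** b).
Proof.
pose T a b c : J := jassociator (a ** b) y c.
have sT a1 b1 c1 : T a1 b1 c1 = T b1 a1 c1 by rewrite /T (jmulC a1).
have D2 a1 c1 : {morph T a1 ^~ c1 : x z / x + z}.
  by move=> x z; rewrite /T /jassociator jmulDr !jmulDl opprD addrACA.
have D3 a1 b1 : {morph T a1 b1 : x z / x + z}.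
  by move=> x z; rewrite /T /jassociator !jmulDr opprD addrACA.
have D1 b1 c1 : {morph (fun a => T a b1 c1) : x z / x + z}.
  by move=> x z; rewrite !(sT _ b1) D2.
have T0 a1 : T a1 a1 a1 = 0 by rewrite /T /jassociator jordan_identity subrr.
apply/eqP; rewrite -subr_eq0 -(polarization D1 D2 D3 sT T0 a b c); apply/eqP.
by rewrite /T /jassociator !opprD addrACA; congr (_ + _); rewrite addrACA.
Qed.

Definition inner y a x := y ** (a ** x) - a ** (y ** x).

(** The linearized identity read as a formula for the multiplication by (ab)y:
    it is a polynomial in the multiplications by a, b, y and by their products
    of two. *)
Lemma jmul_composite a b y c :
  ((a ** b) ** y) ** c = (a ** b) ** (y ** c) + (y ** a) ** (b ** c)
     + (y ** b) ** (a ** c) - a ** (y ** (b ** c)) - b ** (y ** (a ** c)).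
Proof.
apply/eqP; rewrite eq_sym !subr_eq eq_sym; apply/eqP.
have := jordan_linearized a b c y.
rewrite (jmulC a (y ** _)) (jmulC b (y ** _)) !(jmulC y (_ ** _)).
by rewrite (jmulC c a) (jmulC (y ** a)) (jmulC (y ** b)) addrAC => ->.
Qed.
(** In [jmul_composite] the three positive terms are symmetric in a and y;
    subtracting the formula with a and y exchanged leaves the Leibniz rule. *)
Lemma inner_derivation y a b c :
  inner y a (b ** c) = inner y a b ** c + b ** inner y a c.
Proof.
rewrite /inner jmulBl jmulBr (jmulC y (a ** b)) (jmulC a (y ** b)) (jmulC y b).
rewrite !jmul_composite.
rewrite (jmulC b y) (jmulC a y).
set P := _ + _ ** (b ** c) + _; set A := a ** (y ** _); set B := b ** (y ** _).
set B' := b ** (a ** _); set A' := y ** (a ** _).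
have -> : y ** b ** (a ** c) + a ** b ** (y ** c) + y ** a ** (b ** c) = P.
  by rewrite /P [LHS](AC 3 (2*3*1)).
rewrite (opprB (P - B')) (opprB P) [RHS](AC (3*(1*2)*2) ((4*2)*(1*6)*(3*7)*(5*8))).

by rewrite /= !subrr addNr !addr0.
Qed.

End Jordan.

(** * Calculus modulo an ideal *)

Section Subspace.
Variables (K : fieldType) (V : lmodType K).
Implicit Types (S G : set V).

Lemma subspaceD S u v : is_subspace S -> S u -> S v -> S (u + v).
Proof. by case=> _ h Su Sv; rewrite -(scale1r u); apply: h. Qed.
Lemma subspaceZ S (a : K) u : is_subspace S -> S u -> S (a *: u).
Proof. by case=> S0 h Su; rewrite -(addr0 (a *: u)); apply: h. Qed.
Lemma subspaceN S u : is_subspace S -> S u -> S (- u).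
Proof. by move=> hS Su; rewrite -scaleN1r; apply: subspaceZ. Qed.
Lemma subspaceB S u v : is_subspace S -> S u -> S v -> S (u - v).
Proof. by move=> hS Su Sv; apply: subspaceD => //; apply: subspaceN. Qed.
Lemma subspace_sum S (T : Type) (r : seq T) (P : pred T) (F : T -> V) :
  is_subspace S -> (forall i, P i -> S (F i)) -> S (\sum_(i <- r | P i) F i).
Proof.
move=> hS SF; elim/big_rec: _ => [|i v Pi Sv]; first by case: hS.
by apply: subspaceD => //; apply: SF.
Qed.

Lemma lspan_subspace G : is_subspace (lspan G).
Proof.
split; first by move=> S [[]].
move=> a u v Gu Gv S hS; case: (hS) => -[_ h] _.
by apply: h; [exact: (Gu _ hS) | exact: (Gv _ hS)].
Qed.
Lemma sub_lspan G : G `<=` lspan G.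
Proof. exact: sub_gen_smallest. Qed.
Lemma lspan_ind G S : is_subspace S -> G `<=` S -> lspan G `<=` S.
Proof. by move=> hS GS; apply: smallest_sub. Qed.
End Subspace.

Section Congruence.
Variables (K : fieldType) (J : jordanType K) (I : set J).
Hypothesis idI : is_ideal I.
Implicit Types x y z : J.

Definition congm x y := I (x - y).
Local Notation "x ~= y" := (congm x y) (at level 70).
Let subI : is_subspace I := idI.1.

Lemma congm_refl x : x ~= x.
Proof. by rewrite /congm subrr; case: subI. Qed.
Lemma congm_sym x y : x ~= y -> y ~= x.
Proof. by move=> /(subspaceN subI); rewrite opprB. Qed.
Lemma congm_trans y x z : x ~= y -> y ~= z -> x ~= z.
Proof. by move=> xy yz; rewrite /congm -(subrKA y x (- z)); apply: subspaceD. Qed.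
Lemma congm0 x : x ~= 0 <-> I x.
Proof. by rewrite /congm subr0. Qed.
Lemma congmM x y z : y ~= z -> x ** y ~= x ** z.
Proof. by rewrite /congm -jmulBr => /idI.2. Qed.
Lemma congmD x x' y y' : x ~= x' -> y ~= y' -> x + y ~= x' + y'.
Proof. by rewrite /congm opprD addrACA; apply: subspaceD. Qed.
Lemma congmZ (a : K) x y : x ~= y -> a *: x ~= a *: y.
Proof. by rewrite /congm -scalerBr; apply: subspaceZ. Qed.
Lemma congm_sum (T : Type) (r : seq T) (P : pred T) (F G : T -> J) :
  (forall i, P i -> F i ~= G i) ->
  \sum_(i <- r | P i) F i ~= \sum_(i <- r | P i) G i.
Proof. by move=> FG; rewrite /congm -sumrB; apply: subspace_sum. Qed.
Lemma congm_ideal x y : x ~= y -> I y -> I x.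
Proof. by move=> xy Iy; rewrite -(subrK y x); apply: subspaceD. Qed.
End Congruence.

Lemma ideal_gen_ideal (K : fieldType) (J : jordanType K) (G : set J) :
  is_ideal (ideal_gen G).
Proof.
split; first split.
- by move=> S [[[]]].
- move=> a u v Gu Gv S hS; case: (hS) => -[[_ h] _] _.
  by apply: h; [exact: (Gu _ hS) | exact: (Gv _ hS)].
- by move=> x y Gy S hS; case: (hS) => -[_ h] _; apply: h; exact: (Gy _ hS).
Qed.

Lemma free_jordan_ind (K : fieldType) (P : free_jordan K -> Prop) :
  (forall i, P (jvar i)) -> P jone -> (forall f g, P f -> P g -> P (f + g)) ->
  (forall a f, P f -> P (a *: f)) -> (forall f g, P f -> P g -> P (f ** g)) ->
  forall f, P f.
Proof.
move=> Pv P1 PD PZ PM f; rewrite (fj_piE f).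
elim: (generic_quotient.repr f) => [i|||s Ps t Pt|a s Ps|s Ps t Pt].
- exact: Pv.
- have -> : fj_pi JZero = 0 *: jone :> free_jordan K by rewrite scale0r.
  exact: PZ.
- exact: P1.
- by rewrite -fj_pi_add; apply: PD.
- by rewrite -fj_pi_scale; apply: PZ.
- by rewrite -fj_pi_mul; apply: PM.
Qed.

(** * Products of two generators act centrally *)

Section Monomials.
Variable K : fieldType.
Local Notation J := (free_jordan K).
Implicit Types (e : nat * nat) (s : seq (nat * nat)) (x y : J).

(** The letter 0 is the unit of [J(X)], so that the edge (0, i+1) stands for the
    generator of index i, and a monomial with such an edge for a multiple of that
    generator. *)
Definition letter i : J := if i is i'.+1 then jvar i' else jone.
Definition pairing e : J := letter e.1 ** letter e.2.
Definition pmul s x : J := foldr (fun e y => pairing e ** y) x s.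

Hypothesis char2 : 2%N \notin [pchar K].
Variable I : set J.
Hypothesis idI : is_ideal I.
Hypothesis assocI : forall i j k l,
  I (jassociator (jvar i ** jvar j) (jvar k) (jvar l)).
Local Notation "x ~= y" := (congm I x y) (at level 70).
Let subI : is_subspace I := idI.1.

Definition proper_edge e := (0 < e.1)%N && (0 < e.2)%N.

(** A derivation is determined by its values on the generators. *)
Lemma inner_vanish x y :
  (forall i, I (inner x y (jvar i))) -> forall z, I (inner x y z).
Proof.
move=> hv; apply: free_jordan_ind => //.
- by rewrite /inner !jmul1r (jmulC y) subrr; case: subI.
- move=> f g If Ig; rewrite (_ : inner _ _ _ = inner x y f + inner x y g).
    exact: subspaceD.
  by rewrite /inner !jmulDr opprD addrACA.
- move=> a f If; rewrite (_ : inner _ _ _ = a *: inner x y f).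
    exact: subspaceZ.
  by rewrite /inner !jmulZr scalerBr.
- move=> f g If Ig; rewrite inner_derivation //; apply: subspaceD => //.
    by rewrite jmulC; apply: idI.2.
  exact: idI.2.
Qed.

Lemma pairing_letter e i x : proper_edge e ->
  pairing e ** (letter i ** x) ~= letter i ** (pairing e ** x).
Proof.
case: e i => [[|j] [|k]] // [|i] _; rewrite /pairing /=.
  by rewrite !jmul1l; apply: congm_refl.
apply: inner_vanish => l; have := subspaceN subI (assocI j k l i).
by rewrite /inner /jassociator opprB (jmulC (jvar l)) (jmulC _ (jvar i)).
Qed.

Lemma pairing_comm e e' x : proper_edge e ->
  pairing e ** (pairing e' ** x) ~= pairing e' ** (pairing e ** x).
Proof.
move=> pe; apply: inner_vanish => l; rewrite -[I _]/(_ ~= _).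
have [pe'|] := boolP (proper_edge e').
  have h d d' : proper_edge d -> proper_edge d' ->
      pairing d ** (pairing d' ** jvar l)
        ~= letter l.+1 ** (pairing d ** pairing d').
    move=> pd _; rewrite (jmulC (pairing d')); exact: (pairing_letter l.+1).
  apply: (congm_trans idI (h _ _ pe pe')); apply: (congm_sym idI).
  by rewrite (jmulC (pairing e) (pairing e')); apply: h.
rewrite /proper_edge negb_and -!leqNgt !leqn0 /pairing.
case: e' => [[|i'] j'] /=; first by rewrite jmul1l => _; apply: (pairing_letter j').
move=> /eqP->; rewrite jmul1r; exact: (pairing_letter i'.+1).
Qed.

Lemma letter_pmul i s x : all proper_edge s -> letter i ** pmul s x ~= pmul s (letter i ** x).
Proof.
elim: s => [|e s IH] /=; first by move=> _; apply: congm_refl.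
case/andP=> pe ps; apply: (congm_trans idI (y := pairing e ** (letter i ** pmul s x))).
  by apply/(congm_sym idI)/pairing_letter.
by apply: congmM => //; apply: IH.
Qed.

Lemma pmul_congm s x y : x ~= y -> pmul s x ~= pmul s y.
Proof. by move=> xy; elim: s => //= e s IH; apply: congmM. Qed.

Lemma pmul_cat s s' x : pmul (s ++ s') x = pmul s (pmul s' x).
Proof. exact: foldr_cat. Qed.

(** With the letter 0 read as an auxiliary vector, a monomial is of degree at
    most one in that vector. The letter 0 is allowed only as a first endpoint,
    which excludes the edge (0, 0). *)
Definition valid s := all (fun e => 0 < e.2)%N s && (count_mem 0 (unzip1 s) <= 1)%N.

Lemma perm_valid s s' : perm_eq s s' -> valid s = valid s'.
Proof.
move=> ss'; rewrite /valid (perm_all _ ss'); congr (_ && (_ <= _)%N).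
by have /seq.permP h := perm_map fst ss'; apply: h.
Qed.

Lemma valid_proper e s e' :
  valid (e :: s) -> e' \in s -> proper_edge e || proper_edge e'.
Proof.
move=> /andP[/= /andP[e2 /allP h2]] + e's; rewrite /proper_edge e2 (h2 e' e's) !andbT.
case: (posnP e.1) => //= e10; rewrite -[leqRHS]addn0 leq_add2l leqn0.
rewrite lt0n; apply: contraTneq => e'10; rewrite -lt0n -has_count.
by apply/hasP; exists 0%N => //=; rewrite -e'10; apply: map_f.
Qed.

Lemma valid_cons e s : valid (e :: s) -> valid s.
Proof.
case/andP=> /andP[_ s2] s1; apply/andP; split; first exact: s2.
by apply: leq_trans s1; rewrite leq_addl.
Qed.

(** At most one edge of a valid monomial is improper, so any two distinct edges
    have commuting multiplications. *)
Lemma pmul_perm s s' x : valid s -> perm_eq s s' -> pmul s x ~= pmul s' x.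
Proof.
elim: s s' => [|e s IH] s' vs.
  by rewrite perm_sym => /perm_nilP->; apply: congm_refl.
move=> ss'; have := mem_head e s; rewrite (perm_mem ss') => /splitPr s's.
case: s's ss' vs => p q ss' vs.
have sp : perm_eq s (p ++ q).
  by rewrite -(perm_cons e); apply: (perm_trans ss'); rewrite -cat1s perm_catCA.
have push : forall y, pairing e ** pmul p y ~= pmul p (pairing e ** y).
  have {sp} : forall e', e' \in p -> proper_edge e || proper_edge e'.
    by move=> e' pe'; apply: (valid_proper vs); rewrite (perm_mem sp) mem_cat pe'.
  elim: p {ss'} => [|e' p IHp] pp y /=; first exact: congm_refl.
  apply: (congm_trans idI (y := pairing e' ** (pairing e ** pmul p y))).
    have /orP[pe|pe'] := pp e' (mem_head _ _); first exact: pairing_comm.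
    by apply/(congm_sym idI)/pairing_comm.
  by apply: congmM => //; apply: IHp => d dp; apply: pp; rewrite inE dp orbT.
rewrite pmul_cat /=; apply: congm_trans (push _) => //; rewrite -pmul_cat.
by apply: congmM => //; apply: IH => //; apply: valid_cons vs.
Qed.

End Monomials.

(** * Monomials span modulo the ideal *)

Section Spanning.
Variable K : fieldType.
Local Notation J := (free_jordan K).
Implicit Types (e : nat * nat) (s : seq (nat * nat)) (x y : J).
Hypothesis char2 : 2%N \notin [pchar K].
Variable I : set J.
Hypothesis idI : is_ideal I.
Hypothesis assocI : forall i j k l,
  I (jassociator (jvar i ** jvar j) (jvar k) (jvar l)).
Local Notation "x ~= y" := (congm I x y) (at level 70).

Definition mono s : J := pmul s jone.

Definition mono_span (P : seq (nat * nat) -> Prop) : set J :=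
  lspan (I `|` [set mono s | s in P]).

Lemma mono_span_subspace P : is_subspace (mono_span P).
Proof. exact: lspan_subspace. Qed.

Lemma mono_span_congm P x y : x ~= y -> mono_span P y -> mono_span P x.
Proof.
move=> xy Py; rewrite -(subrK y x).
by apply: (subspaceD (mono_span_subspace P)) Py; apply: sub_lspan; left.
Qed.

Lemma mono_span_mono (P : seq (nat * nat) -> Prop) s : P s -> mono_span P (mono s).
Proof. by move=> Ps; apply: sub_lspan; right; exists s. Qed.

Lemma mono_span_sub (P Q : seq (nat * nat) -> Prop) x :
  (forall s, P s -> mono_span Q (mono s)) -> mono_span P x -> mono_span Q x.
Proof.
move=> PQ; apply: (lspan_ind (mono_span_subspace Q)) x => y [Iy|[s Ps <-]]; last exact: PQ.
by apply: sub_lspan; left.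
Qed.

(* A product of pairings applied to one letter, which may be the unit. *)
Let rows s := exists t k, all proper_edge t /\ s = t ++ [:: (0%N, k)].

Let pmul_letter s k : mono (s ++ [:: (0%N, k)]) = pmul s (letter K k).
Proof. by rewrite /mono pmul_cat /= jmul1r /pairing jmul1l. Qed.

Let pres x := forall y, mono_span rows y -> mono_span rows (x ** y).

Let pres_gen x :
  (forall s k, all proper_edge s -> mono_span rows (x ** pmul s (letter K k))) -> pres x.
Proof.
move=> hx; apply: (lspan_ind (S := [set y | mono_span rows (x ** y)])).
  have hS := mono_span_subspace rows.
  split=> [|a u v /= hu hv]; first by rewrite /= jmul0r; case: hS.
  by rewrite jmulDr jmulZr; apply: hS.2.
move=> y [Iy|[s [t [k [pt ->]]] <-]] /=; last by rewrite pmul_letter; apply: hx.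
by apply: sub_lspan; left; apply: idI.2.
Qed.

Let pres_letter i : pres (letter K i).
Proof.
apply: pres_gen => s k ps; apply: mono_span_congm (letter_pmul _ _ _ _ _ _) _ => //.
have row t l : all proper_edge t -> mono_span rows (pmul t (letter K l)).
  by move=> pt; rewrite -pmul_letter; apply: mono_span_mono; exists t, l.
case: i k => [|i] [|k] /=; rewrite ?jmul1l ?jmul1r.
- exact: (row s 0%N).
- exact: (row s k.+1).
- exact: (row s i.+1).
- have := row (rcons s (i.+1, k.+1)) 0%N; rewrite -cats1 pmul_cat /= jmul1r.
  by apply; rewrite all_cat ps.
Qed.

Let pres_pairing e : proper_edge e -> pres (pairing K e).
Proof.
move=> pe; apply: pres_gen => s k ps; rewrite -[_ ** _]/(pmul (e :: s) _).
by rewrite -pmul_letter; apply: mono_span_mono; exists (e :: s), k; rewrite /= pe.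
Qed.

Let pres_composite p q r :
  pres p -> pres q -> pres r -> pres (p ** q) -> pres (r ** p) -> pres (r ** q) ->
  pres ((p ** q) ** r).
Proof.
move=> hp hq hr hpq hrp hrq y hy; rewrite jmul_composite //.
have hS := mono_span_subspace rows.
apply: (subspaceB hS); last exact: hq (hr _ (hp _ hy)).
apply: (subspaceB hS); last exact: hp (hr _ (hq _ hy)).
apply: (subspaceD hS); last exact: hrq (hp _ hy).
by apply: (subspaceD hS); [exact: hpq (hr _ hy) | exact: hrp (hq _ hy)].
Qed.

(* Nonassociative words are needed for an induction on length: the formula for
   (pq)r involves pq, rp and rq, which are not subwords of it. *)
Inductive nonassoc_word := NWLetter of nat | NWMul of nonassoc_word & nonassoc_word.
Fixpoint nword_eval t : J :=
  match t with NWLetter i => jvar i | NWMul a b => nword_eval a ** nword_eval b end.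
Fixpoint nword_length t : nat :=
  match t with NWLetter i => 1%N | NWMul a b => (nword_length a + nword_length b)%N end.
Let length_gt0 t : (0 < nword_length t)%N.
Proof. by elim: t => //= a la b lb; rewrite addn_gt0 la. Qed.

Let pres_word t : pres (nword_eval t).
Proof.
have [n] := ubnP (nword_length t); elim: n t => // n IH [i _|a b].
  exact: (pres_letter i.+1).
have comp p q r : (nword_length p + nword_length q + nword_length r <= n)%N ->
    pres ((nword_eval p ** nword_eval q) ** nword_eval r).
  move=> len; have [[lp lq] lr] := (length_gt0 p, length_gt0 q, length_gt0 r).
  by apply: pres_composite; [apply: (IH p)|apply: (IH q)|apply: (IH r)
    |apply: (IH (NWMul p q))|apply: (IH (NWMul r p))|apply: (IH (NWMul r q))] => /=; lia.
case: a => [i|p q]; last exact: comp.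
case: b => [j|p q] /= len; first exact: (@pres_pairing (i.+1, j.+1)).
by rewrite jmulC; apply: (comp p q (NWLetter i)) => /=; lia.
Qed.

Let pres_all x : pres x.
Proof.
pose Q : set J := lspan (jone |` range nword_eval).
have hQ : is_subspace Q by apply: lspan_subspace.
have lin z : is_subspace [set y | Q (y ** z)].
  split=> [|a u v /= hu hv]; first by rewrite /= jmulC jmul0r; case: hQ.
  by rewrite jmulDl jmulZl; apply: hQ.2.
have QM y z : Q y -> Q z -> Q (y ** z).
  move=> Qy Qz; move: y Qy; apply: (lspan_ind (lin z)) => y [->|[t _ <-]].
    by rewrite /= jmul1l.
  rewrite /= jmulC; move: z Qz; apply: (lspan_ind (lin _)) => z [->|[u _ <-]].
    by rewrite /= jmul1l; apply: sub_lspan; right; exists t.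
  by apply: sub_lspan; right; exists (NWMul u t).
have Qx : Q x.
  apply: free_jordan_ind x => //.
  - by move=> i; apply: sub_lspan; right; exists (NWLetter i).
  - by apply: sub_lspan; left.
  - by move=> f g; apply: subspaceD.
  - by move=> a f; apply: subspaceZ.
apply: (lspan_ind (S := pres)) x Qx => [|x [->|[t _ <-]]]; last exact: pres_word.
  have hS := mono_span_subspace rows.
  split=> [|a u v hu hv] y hy; first by rewrite jmulC jmul0r; case: hS.
  by rewrite jmulDl jmulZl; apply: hS.2; [apply: hu | apply: hv].
by move=> y; rewrite jmul1l.
Qed.

(** A product of x with the unit is the image of 1 under the multiplication by x,
    which preserves the span of the monomials because it is a polynomial in the
    multiplications by letters and by pairings. *)
Lemma mono_span_valid x : mono_span valid x.
Proof.
apply: (mono_span_sub (P := rows)) => [s [t [k [pt ->]]]|].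
  have pt' : all (fun e => 0 < e.2)%N t by apply: sub_all pt => e /andP[].
  have pt1 : count_mem 0%N (unzip1 t) = 0%N.
    rewrite count_map; apply/eqP; rewrite -leqn0 leqNgt -has_count.
    by apply/hasPn => e /(allP pt) /andP[/=]; rewrite lt0n.
  have [->|k0] := posnP k.
    rewrite pmul_letter -[letter K 0]/(jone) -/(mono t).
    by apply: mono_span_mono; rewrite /valid pt' pt1.
  apply: mono_span_mono; rewrite /valid all_cat pt' /= k0 /=.
  by rewrite /unzip1 map_cat count_cat -/(unzip1 t) pt1.
rewrite -(jmul1r x); apply: pres_all; rewrite -[jone]/(letter K 0) -[letter K 0]/(pmul [::] _).
by rewrite -pmul_letter; apply: mono_span_mono; exists [::], 0%N.
Qed.

Lemma mono_perm s s' : valid s -> perm_eq s s' -> mono s ~= mono s'.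
Proof. exact: pmul_perm. Qed.

Definition orient e := (minn e.1 e.2, maxn e.1 e.2).
(** Any decidable total order would do: sorting only selects one representative
    in each class of lists up to permutation. *)
Definition edge_le : rel (nat * nat) := relpre pickle leq.
Definition standard s := all (fun e => e.1 <= e.2)%N s && sorted edge_le s.
Definition standardize s := sort edge_le (map orient s).
Definition weight s := (\sum_(e <- s) e.1 * e.2)%N.

Lemma standardize_standard s : standard (standardize s).
Proof.
rewrite /standard sort_sorted ?andbT; last by move=> e e'; apply: leq_total.
rewrite all_sort all_map; apply/allP => e _ /=.
by rewrite leq_max geq_minl.
Qed.

Lemma standard_inj s s' : standard s -> standard s' -> perm_eq s s' -> s = s'.
Proof.
move=> /andP[_ ss] /andP[_ ss']; apply: sorted_eq ss ss'.
  by move=> y x z; apply: leq_trans.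
by move=> e e' /anti_leq/(pcan_inj pickleK).
Qed.

Lemma weight_perm s s' : perm_eq s s' -> weight s = weight s'.
Proof. exact: perm_big. Qed.

Lemma weight_standardize s : weight (standardize s) = weight s.
Proof.
rewrite (weight_perm (permEl (perm_sort _ _))) /weight big_map.
by apply: eq_bigr => -[i j] _ /=; rewrite /minn /maxn; case: ltnP => // _; rewrite mulnC.
Qed.

Lemma pairing_orient e : pairing K (orient e) = pairing K e.
Proof.
by case: e => i j; rewrite /orient /minn /maxn /=; case: ltnP => // _; apply: jmulC.
Qed.

Lemma valid_orient s : valid s -> valid (map orient s).
Proof.
case/andP=> s2 s1; apply/andP; split.
  by rewrite all_map; apply: sub_all s2 => e /=; rewrite leq_max => ->; rewrite orbT.
apply: leq_trans s1; rewrite /unzip1 -map_comp !count_map.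
rewrite (@eq_in_count _ _ (preim fst (pred1 0%N))) // => e /(allP s2) /= e2.
case: e e2 => i j /=; lia.
Qed.

Lemma mono_standardize s : valid s ->
  valid (standardize s) /\ mono s ~= mono (standardize s).
Proof.
move=> vs; have vo := valid_orient vs.
have so : perm_eq (map orient s) (standardize s) by rewrite perm_sym perm_sort.
split; first by rewrite -(perm_valid so).
rewrite (_ : mono s = mono (map orient s)); first exact: mono_perm.
by rewrite /mono; elim: s {vs vo so} => //= e s ->; rewrite pairing_orient.
Qed.

Lemma mono_span_standard x : mono_span (fun s => valid s /\ standard s) x.
Proof.
apply: mono_span_sub (mono_span_valid x) => s vs.
have [vt /mono_span_congm] := mono_standardize vs; apply.
by apply: mono_span_mono; split=> //; apply: standardize_standard.
Qed.

Lemma mono_span_sum (P : seq (nat * nat) -> Prop) x : mono_span P x ->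
  exists (L : seq (seq (nat * nat))) (c : seq (nat * nat) -> K),
    [/\ uniq L, {in L, forall s, P s} & x ~= \sum_(s <- L) c s *: mono s].
Proof.
pose S : set J := [set x | exists L c, [/\ uniq L, {in L, forall s, P s} &
  x ~= \sum_(s <- L) c s *: mono s]].
apply: (lspan_ind (S := S)) x => [|x [Ix|[s Ps <-]]]; last first.
- exists [:: s], (fun=> 1); split=> // [s'|]; first by rewrite inE => /eqP->.
  by rewrite big_seq1 scale1r; apply: congm_refl.
- by exists [::], (fun=> 0); split=> //; rewrite big_nil; apply/congm0.
split.
  by exists [::], (fun=> 0); split=> //; rewrite big_nil; apply: congm_refl.
move=> a u v [L1 [c1 [u1 P1 E1]]] [L2 [c2 [u2 P2 E2]]].
pose cut (L : seq (seq (nat * nat))) (c : seq (nat * nat) -> K) s := if s \in L then c s else 0.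
pose L := undup (L1 ++ L2).
have sum_cut L0 c0 : uniq L0 -> {subset L0 <= L} ->
    \sum_(s <- L) cut L0 c0 s *: mono s = \sum_(s <- L0) c0 s *: mono s.
  move=> uL0 sub; rewrite (eq_bigr (fun s => if s \in L0 then c0 s *: mono s else 0)).
    rewrite -big_mkcond -big_filter; apply: perm_big; apply: uniq_perm => //.
      by rewrite filter_uniq ?undup_uniq.
    by move=> s; rewrite mem_filter; case: (boolP (s \in L0)) => // /sub.
  by move=> s _; rewrite /cut; case: ifP => // _; rewrite scale0r.
exists L, (fun s => a * cut L1 c1 s + cut L2 c2 s); split.
- exact: undup_uniq.
- by move=> s; rewrite mem_undup mem_cat => /orP[/P1|/P2].
under eq_bigr => s _ do rewrite scalerDl -scalerA.
rewrite big_split /= -scaler_sumr !sum_cut //.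
- by apply: (congmD idI) => //; apply: (congmZ idI).
- by move=> s s2; rewrite mem_undup mem_cat s2 orbT.
- by move=> s s1; rewrite mem_undup mem_cat s1.
Qed.
End Spanning.

(** * Chains of edges and the straightening by minors *)

Section Chains.
Implicit Types (e : nat * nat) (s c : seq (nat * nat)).

Definition edge_lt : rel (nat * nat) := fun e e' => (e.1 < e'.1)%N && (e.2 < e'.2)%N.

(** A covering by n antichains; an antichain of oriented edges is a nest of
    intervals. *)
Definition coverable n s := exists h : nat * nat -> nat,
  {in s, forall e, (h e < n)%N} /\
  {in s &, forall e e', h e = h e' -> ~~ edge_lt e e'}.

(** Mirsky's dual of Dilworth's theorem: give colour 0 to the minimal edges and
    colour the remaining ones by induction; a chain among the remaining edges
    extends downwards. *)
Lemma coverable_or_chain n s :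
  coverable n s \/ exists2 c, sorted edge_lt c & size c = n.+1 /\ {subset c <= s}.
Proof.
elim: n s => [|n IH] s.
  case: s => [|e s]; [left; exists (fun=> 0%N) => // | right].
  by exists [:: e] => //; split=> // x; rewrite !inE => ->.
pose above e := has (edge_lt^~ e) s.
have [[h [hn hlt]]|[c0 lt_c [size_c sub_c]]] := IH (filter above s).
  left; exists (fun e => if above e then (h e).+1 else 0%N); split=> [e es|e e' es e's].
    by case: ifPn => // ae; rewrite ltnS hn // mem_filter ae.
  case: (boolP (above e')) => [ae'|]; last first.
    by move=> /hasPn/(_ e es).
  case: (boolP (above e)) => // ae [] /hlt; apply; rewrite mem_filter ?ae ?ae' //.
case: c0 lt_c size_c sub_c => // e c lt_c size_c sub_c.
right; have := sub_c e (mem_head _ _); rewrite mem_filter => /andP[/hasP[e0 e0s lt_e] es].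
exists (e0 :: e :: c); first by rewrite /= lt_e.
split; first by rewrite -size_c.
by move=> x; rewrite inE => /predU1P[->//|/sub_c]; rewrite mem_filter => /andP[].
Qed.

Lemma coverable_size n s : (size s <= n)%N -> coverable n s.
Proof.
move=> sn; exists (index^~ s); split=> [e es|e e' es e's he].
  by apply: leq_trans sn; rewrite index_mem.
by rewrite -(nth_index e es) he nth_index // /edge_lt ltnn.
Qed.

End Chains.

Lemma uniq_sub_perm (T : eqType) (c s : seq T) :
  uniq c -> {subset c <= s} -> exists r, perm_eq s (c ++ r).
Proof.
elim: c s => [|x c IH] s /=; first by exists s.
case/andP=> xc uc cs; have xs := cs x (mem_head _ _).
have [|r sr] := IH (rem x s) uc.
  move=> y yc; have := cs y; rewrite inE yc orbT => /(_ isT) ys.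
  have : y \in x :: rem x s by rewrite -(perm_mem (perm_to_rem xs)).
  by rewrite inE => /predU1P[yx|//]; rewrite -yx yc in xc.
by exists r; apply: perm_trans (perm_to_rem xs) _; rewrite /= perm_cons.
Qed.

Section Rearrangement.
Variables (n : nat) (a b : 'I_n -> nat).
Hypothesis a_incr : forall i j : 'I_n, (i < j)%N -> (a i < a j)%N.
Hypothesis b_incr : forall i j : 'I_n, (i < j)%N -> (b i < b j)%N.

(** The least moved point i is sent above itself, and its preimage comes after
    it. *)
Lemma perm_inversion (sigma : 'S_n) :
  sigma != 1%g -> exists i j : 'I_n, (i < j)%N /\ (sigma j < sigma i)%N.
Proof.
move=> sn1; have [i0 mov] : exists i, sigma i != i.
  apply/existsP; apply: contraNT sn1 => /existsPn fix_.
  by apply/eqP/permP => i; rewrite perm1; apply/eqP; rewrite -[_ == _]negbK.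
have [i si imin] := @arg_minnP _ i0 (fun i => sigma i != i) (fun i => i : nat) mov.
exists i, (sigma^-1%g i); rewrite permKV.
have fixl (k : 'I_n) : (k < i)%N -> sigma k = k.
  by move=> ki; apply/eqP; apply: contraTT ki => /imin; rewrite -leqNgt.
have gt_i (k : 'I_n) : k != i -> (k < i)%N = false -> (i < k)%N.
  by move=> ki kli; rewrite ltn_neqAle leqNgt kli andbT eq_sym; apply: contraNneq ki => /val_inj->.
split; apply: gt_i => //.
- by apply: contraNneq si => e; rewrite -{1}e permKV.
- apply/negP => lt; have := fixl _ lt; rewrite permKV => e.
  by rewrite -e ltnn in lt.
- by apply/negP => /fixl/perm_inj/eqP; rewrite (negbTE si).
Qed.

Let score (sigma : 'S_n) := (\sum_i a i * b (sigma i))%N.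

Let score_lt (sigma : 'S_n) : sigma != 1%g -> exists tau, (score sigma < score tau)%N.
Proof.
move=> /perm_inversion[i [j [ij sij]]]; exists (tperm i j * sigma)%g.
have ji : j != i by rewrite neq_ltn ij orbT.
rewrite /score (bigD1 i) // (bigD1 j) //= [ltnRHS](bigD1 i) // (bigD1 j) //=.
rewrite !permM tpermL tpermR.
have -> : (\sum_(k | (k != i) && (k != j)) a k * b ((tperm i j * sigma)%g k)
         = \sum_(k | (k != i) && (k != j)) a k * b (sigma k))%N.
  by apply: eq_bigr => k /andP[ki kj]; rewrite permM tpermD // eq_sym.
by rewrite !addnA ltn_add2r; have := a_incr ij; have := b_incr sij; nia.
Qed.

(** Exchanging the values at an inversion increases the sum, so that a
    permutation with maximal sum is the identity. *)
Lemma rearrangement (sigma : 'S_n) : sigma != 1%g ->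
  (\sum_i a i * b (sigma i) < \sum_i a i * b i)%N.
Proof.
have [m _ m_max] := @arg_maxnP _ (1%g : 'S_n) xpredT score isT.
have m1 : m = 1%g.
  apply/eqP; apply: contraT => /score_lt[tau]; rewrite ltnNge => /negP[].
  exact: m_max.
have -> : (\sum_i a i * b i)%N = score m.
  by rewrite m1; apply: eq_bigr => i _; rewrite perm1.
by move=> /score_lt[tau lt]; apply: leq_trans lt (m_max _ _).
Qed.

End Rearrangement.

Section Reduction.
Variable K : fieldType.
Local Notation J := (free_jordan K).
Implicit Types (e : nat * nat) (s r : seq (nat * nat)) (x y : J).

Lemma jeval0 (A : jordanType K) (w : nat -> A) : jeval w 0 = 0.
Proof. by have := jevalZ w 0 0; rewrite !scale0r. Qed.

Lemma jeval_alt_poly (A : jordanType K) (w : nat -> A) n :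
  jeval w (alt_poly K n) = \sum_(sigma : 'S_n.+1) (-1) ^+ sigma *:
    foldl (fun p (k : 'I_n) => p ** (w (n.+1 + k)%N ** w (sigma (lift ord0 k))))
          (w (sigma ord0)) (enum 'I_n).
Proof.
rewrite (big_morph _ (jevalD w) (jeval0 w)); apply: eq_bigr => sigma _.
rewrite jevalZ; congr (_ *: _).
rewrite -(jeval_var w (sigma ord0)).
elim: (enum 'I_n) (jvar _) => //= k l IH x.
by rewrite IH !jevalM !jeval_var.
Qed.

Hypothesis char2 : 2%N \notin [pchar K].
Variable I : set J.
Hypothesis idI : is_ideal I.
Hypothesis assocI : forall i j k l,
  I (jassociator (jvar i ** jvar j) (jvar k) (jvar l)).
Local Notation "x ~= y" := (congm I x y) (at level 70).
Variable n : nat.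
Hypothesis altI : forall g : nat -> nat, I (jeval (fun i => jvar (g i)) (alt_poly K n)).

Definition minor_edges (a b : 'I_n.+1 -> nat) (sigma : 'S_n.+1) :=
  [seq (a k, b (sigma k)) | k <- enum 'I_n.+1].

(** The minor with rows a and columns b is the consequence of the alternating
    polynomial obtained by substituting the letters b for its first n+1 variables,
    the letters a k with k > 0 for the other ones, and multiplying by the letter
    a 0. That letter may be the unit, which gives the relations of odd degree.
    The factor r is an arbitrary product of further edges. *)
Lemma minor_relation (a b : 'I_n.+1 -> nat) r :
  (forall k, 0 < b k)%N -> (forall k, 0 < a (lift ord0 k))%N ->
  I (\sum_(sigma : 'S_n.+1) (-1) ^+ sigma *: mono K (r ++ minor_edges a b sigma)).
Proof.
move=> b0 a0.
(* The letters involved are positive: the predecessor of a letter is the index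
   of its generator. *)
pose g i := (if (i <= n)%N then b (inord i) else a (inord (i - n)%N)).-1.
pose tl (sigma : 'S_n.+1) := [seq (a (lift ord0 k), b (sigma (lift ord0 k))) | k <- enum 'I_n].
have gb k : jvar (g (k : 'I_n.+1)) = letter K (b k).
  by rewrite /g -ltnS ltn_ord inord_val; case: (b k) (b0 k).
have ga (k : 'I_n) : jvar (g (n.+1 + k)%N) = letter K (a (lift ord0 k)).
  rewrite /g ifN -?ltnNge ?leq_addr // subSn ?leq_addr // subDnCA // subnn addn0.
  rewrite (_ : inord _ = lift ord0 k); first by case: (a _) (a0 k).
  by apply/val_inj; rewrite /= inordK ?ltnS.
have Ialt := idI.2 (letter K (a ord0)) _ (altI g).
apply: (congm_ideal idI (y := pmul r (letter K (a ord0)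
  ** jeval (fun i => jvar (g i)) (alt_poly K n)))); last first.
  by elim: r => //= e r IH; apply: idI.2.
rewrite jeval_alt_poly linear_sum.
have -> : forall (F : 'S_n.+1 -> J), pmul r (\sum_sigma F sigma) = \sum_sigma pmul r (F sigma).
  by move=> F; elim: r => //= e r ->; rewrite linear_sum.
apply: (congm_sum idI) => sigma _; rewrite linearZ /=.
have -> : forall (c : K) y, pmul r (c *: y) = c *: pmul r y.
  by move=> c y; elim: r => //= e r ->; rewrite jmulZr.
apply: (congmZ idI); rewrite /mono pmul_cat; apply: pmul_congm => //.
have -> : foldl (fun p (k : 'I_n) => p ** (jvar (g (n.+1 + k)%N) ** jvar (g (sigma (lift ord0 k)))))
     (jvar (g (sigma ord0))) (enum 'I_n) = pmul (rev (tl sigma)) (letter K (b (sigma ord0))).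
  rewrite /pmul -(foldl_rev (fun y e => pairing K e ** y)) revK -gb /tl.
  elim: (enum 'I_n) (jvar _) => //= k l IH y.
  by rewrite -IH ga gb jmulC.
have ptl : all proper_edge (rev (tl sigma)).
  by rewrite all_rev all_map; apply/allP => k _; rewrite /proper_edge /= a0 b0.
apply: (congm_trans idI (y := mono K (rcons (rev (tl sigma)) (a ord0, b (sigma ord0))))).
  apply: mono_perm => //.
    rewrite /minor_edges /valid all_map; apply/andP; split; first by apply/allP => k _ /=.
    rewrite enum_ordSl /= /unzip1 -!map_comp count_map.
    rewrite (_ : count _ _ = 0%N) ?addn0 ?leq_b1 //.
    by apply/eqP; rewrite -leqn0 leqNgt -has_count; apply/hasPn => k _ /=; rewrite -lt0n.
  rewrite /minor_edges enum_ordSl /= -map_comp perm_sym perm_rcons perm_cons perm_rev.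
  by rewrite perm_refl.
apply: (congm_sym idI); rewrite /mono -cats1 pmul_cat /= jmul1r.
exact: letter_pmul.
Qed.

(** A chain c of n+1 edges is the diagonal of the minor whose rows are the first
    endpoints and whose columns are the second endpoints of its edges. The other
    terms of the minor have smaller weight, and the induction is on the weight.
    Only the first row of the minor may be the letter 0, the rows being strictly
    increasing. *)
Lemma mono_span_coverable x : mono_span I (fun s => [/\ valid s, standard s & coverable n s]) x.
Proof.
apply: mono_span_sub (mono_span_valid char2 idI assocI x) => s.
have [m] := ubnP (weight s); elim: m s => // m IH s ws vs.
have [vt st] := mono_standardize char2 idI assocI vs.
apply: (mono_span_congm st); move: vt ws; rewrite -weight_standardize.
have := standardize_standard s; move: (standardize s) => {st vs} {}s ss vs ws.
have [cov|[c lt_c [size_c sub_c]]] := coverable_or_chain n s.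
  by apply: mono_span_mono.
have lt_tr : transitive edge_lt.
  move=> e e' e'' /andP[a1 b1] /andP[a2 b2].
  by rewrite /edge_lt (ltn_trans a1 a2) (ltn_trans b1 b2).
have uc : uniq c by apply: (sorted_uniq lt_tr _ lt_c) => e; rewrite /edge_lt ltnn.
have [r scr] := uniq_sub_perm uc sub_c.
pose a (k : 'I_n.+1) := (nth (0, 0)%N c k).1; pose b (k : 'I_n.+1) := (nth (0, 0)%N c k).2.
have lt_nth (i j : 'I_n.+1) : (i < j)%N -> edge_lt (nth (0, 0)%N c i) (nth (0, 0)%N c j).
  by move=> ij; apply: (sorted_ltn_nth lt_tr (0, 0)%N lt_c) => //; rewrite inE size_c.
have b0 k : (0 < b k)%N.
  case/andP: vs => /allP + _; apply; apply: sub_c; apply: mem_nth.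
  by rewrite size_c.
have a0 k : (0 < a (lift ord0 k))%N.
  by apply: leq_ltn_trans (leq0n (a ord0)) _; case/andP: (lt_nth ord0 (lift ord0 k) isT).
have c_minor : minor_edges a b 1%g = c.
  apply: (@eq_from_nth _ (0, 0)%N); first by rewrite size_map size_enum_ord.
  rewrite size_map size_enum_ord => i lt_i.
  rewrite (nth_map ord0) ?size_enum_ord // perm1 /a /b nth_enum_ord //.
  by case: nth.
have perm_sr : perm_eq s (r ++ minor_edges a b 1%g) by rewrite c_minor perm_sym perm_catC perm_sym.
apply: (mono_span_congm (mono_perm char2 idI assocI vs perm_sr)).
have hS := mono_span_subspace I (fun s => [/\ valid s, standard s & coverable n s]).
have := minor_relation r b0 a0; rewrite (bigD1 1%g) //= odd_perm1 expr0 scale1r.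
set rest := \sum_(i | _) _ => rel; rewrite -[mono _ _](addrK rest).
apply: (subspaceB hS); first by apply: sub_lspan; left.
rewrite /rest; apply: (subspace_sum _ hS) => sigma sigma1; apply: (subspaceZ _ hS).
have w_minor tau : weight (r ++ minor_edges a b tau) = (weight r + \sum_k a k * b (tau k))%N.
  by rewrite /weight big_cat big_map big_enum.
apply: IH.
  rewrite ltnS in ws; apply: leq_trans ws; rewrite (weight_perm perm_sr) !w_minor ltn_add2l.
  have a_incr (i j : 'I_n.+1) : (i < j)%N -> (a i < a j)%N by move=> /lt_nth/andP[].
  have b_incr (i j : 'I_n.+1) : (i < j)%N -> (b i < b j)%N by move=> /lt_nth/andP[].
  rewrite [ltnRHS](eq_bigr (fun k => a k * b k)%N); last by move=> k _; rewrite perm1.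
  exact: rearrangement.
move: vs; rewrite (perm_valid perm_sr) /valid /unzip1 !all_cat !map_cat.
rewrite -!map_comp => /andP[/andP[-> _] a1].
by apply/andP; split; [rewrite all_map; apply/allP => k _ /= | exact: a1].
Qed.

End Reduction.

(** * Polynomial functions over an infinite field *)

Section CoefficientExtraction.
Variable K : fieldType.
Hypothesis infK : infinite_set [set: K].

Lemma poly_vanish (p : {poly K}) : (forall x, p.[x] = 0) -> p = 0.
Proof.
move=> p0; have [B _ sizeB] := infinite_set_fset (size p) infK.
apply: contraTeq sizeB => pn0; rewrite -ltnNge.
apply: max_poly_roots => //; last exact: finmap.fset_uniq.
by apply/allP => x _; apply/rootP.
Qed.

(** Several terms j may have the same exponents m j; only the sum of their
    coefficients is determined. One variable is eliminated at a time, by reading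
    the vanishing sum as a polynomial in that variable. *)
Lemma monomials_independent (X : eqType) (Y : Type) (vs : seq X) (r : seq Y)
    (P : pred Y) (a : Y -> K) (m : Y -> X -> nat) (m0 : X -> nat) :
  uniq vs ->
  (forall t : X -> K, \sum_(j <- r | P j) a j * \prod_(v <- vs) t v ^+ m j v = 0) ->
  \sum_(j <- r | P j && all (fun v => m j v == m0 v) vs) a j = 0.
Proof.
elim: vs P => [|v vs IH] P /=.
  move=> _ /(_ (fun=> 0)) E; rewrite -[RHS]E; apply: eq_big => j; first by rewrite andbT.
  by rewrite big_nil mulr1.
case/andP=> vvs uvs E.
rewrite (eq_bigl (fun j =>
  (P j && (m j v == m0 v)) && all (fun v => m j v == m0 v) vs)); last first.
  by move=> j; rewrite andbA.
apply: IH => // t.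
pose p := \sum_(j <- r | P j) (a j * \prod_(v <- vs) t v ^+ m j v) *: 'X^(m j v).
have p0 : p = 0.
  apply: poly_vanish => x; rewrite -(E (fun u => if u == v then x else t u)).
  rewrite /p horner_sum; apply: eq_bigr => j _.
  rewrite hornerZ hornerXn big_cons eqxx -mulrA; congr (_ * _); rewrite mulrC; congr (_ * _).
  by apply: eq_big_seq => u uvs'; rewrite ifN //; apply: contraNneq vvs => <-.
transitivity p`_(m0 v); last by rewrite p0 coef0.
rewrite /p coef_sum big_mkcondr; apply: eq_bigr => j _; rewrite coefZ coefXn eq_sym.
by case: eqP; rewrite ?mulr1 ?mulr0.
Qed.

End CoefficientExtraction.

(** * Nests of intervals have the least weight *)

Lemma seq_argmax (T : eqType) (f : T -> nat) (s : seq T) : s != [::] ->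
  exists2 x, x \in s & {in s, forall y, (f y <= f x)%N}.
Proof.
elim: s => // x [|y s] IH _.
  by exists x; rewrite ?mem_head // => y; rewrite inE => /eqP->.
have [//|z zs zmax] := IH.
case: (leqP (f x) (f z)) => [le_xz|lt_zx].
  exists z; first by rewrite inE zs orbT.
  by move=> u; rewrite inE => /predU1P[->|/zmax].
exists x; first exact: mem_head.
move=> u; rewrite inE => /predU1P[->//|/zmax le_uz].
exact: leq_trans le_uz (ltnW lt_zx).
Qed.

Section NestedMinimality.
Local Notation cedge := ((nat * nat) * nat)%type.
Implicit Types (x y z : cedge) (p q : seq cedge).

(** An edge of colour k joins two vertices of colour k; the multiset of vertices is
    the degree sequence of the coloured multigraph, hence the exponent of the
    corresponding monomial in the coordinates. *)
Definition vertices q : seq (nat * nat) :=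
  flatten [seq [:: (x.1.1, x.2); (x.1.2, x.2)] | x <- q].

Definition nested q := {in q &, forall x y, x.2 = y.2 -> ~~ edge_lt x.1 y.1}.

Lemma vertices_perm p q : perm_eq p q -> perm_eq (vertices p) (vertices q).
Proof. by move=> pq; apply/perm_flatten/perm_map. Qed.

Lemma verticesP v q :
  reflect (exists2 x, x \in q & x.2 = v.2 /\ (x.1.1 = v.1 \/ x.1.2 = v.1)) (v \in vertices q).
Proof.
apply: (iffP flatten_mapP) => -[x xq].
  by rewrite !inE => /orP[] /eqP->; exists x => //=; split=> //; [left|right].
case: v => v k /= [<- [<-|<-]]; exists x => //; rewrite !inE eqxx ?orbT //.
Qed.

(** Let x0 = (a, b) be an outermost edge of its colour in q, so that a is the
    least and b the greatest vertex of that colour. If x0 is an edge of p, remove it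
    from both. Otherwise p has two different edges (a, c) and (d, b); replacing
    them by (a, b) and {c, d} keeps the vertices and decreases the weight by
    (d - a) (b - c) > 0. *)
Lemma nested_minimal p q :
  all (fun x => x.1.1 <= x.1.2)%N p -> all (fun x => x.1.1 <= x.1.2)%N q ->
  perm_eq (vertices p) (vertices q) -> nested q ->
  (weight (unzip1 q) <= weight (unzip1 p))%N /\
  ((weight (unzip1 p) <= weight (unzip1 q))%N -> perm_eq p q).
Proof.
have wcons x (s : seq cedge) : weight (unzip1 (x :: s)) = (x.1.1 * x.1.2 + weight (unzip1 s))%N.
  by rewrite /weight /= big_cons.
have wperm (s s' : seq cedge) : perm_eq s s' -> weight (unzip1 s) = weight (unzip1 s').
  by move=> ss'; apply/weight_perm/perm_map.
have cedge_eq x x' : x.1.1 = x'.1.1 -> x.1.2 = x'.1.2 -> x.2 = x'.2 -> x = x'.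
  by case: x x' => -[i j] k [[i' j'] k'] /= -> -> ->.
have [n] := ubnP (size q); elim: n p q => // n IH p q size_q op oq pq nq.
have [q0|] := eqVneq q [::].
  rewrite q0 in pq *; case: p {op} pq => // x p /perm_size /=.
  by [].
case: q size_q oq pq nq => // y q1; move: (y :: q1) (mem_head y q1) => q yq size_q oq pq nq _.
(* A longest interval of a nest contains all the others. *)
have [|x0] := @seq_argmax _ (fun x => x.1.2 - x.1.1)%N [seq x <- q | x.2 == y.2].
  apply: contraTneq yq => e.
  by rewrite -[y \in q]andTb -(eqxx y.2) -(mem_filter (fun x => x.2 == y.2)) e.
rewrite mem_filter => /andP[/eqP x0y x0q] x0max.
have sub_x0 x : x \in q -> x.2 = x0.2 -> (x0.1.1 <= x.1.1)%N /\ (x.1.2 <= x0.1.2)%N.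
  move=> xq xx0; have := x0max x; rewrite mem_filter xq xx0 x0y eqxx => /(_ isT).
  have := nq x x0 xq x0q xx0; have := nq x0 x x0q xq (esym xx0).
  have := allP oq _ xq; have := allP oq _ x0q; rewrite /edge_lt /=; lia.
have sub_p x : x \in p -> x.2 = x0.2 -> (x0.1.1 <= x.1.1)%N /\ (x.1.2 <= x0.1.2)%N.
  move=> xp xx0; split.
    have : (x.1.1, x.2) \in vertices p by apply/verticesP; exists x => //; split=> //; left.
    rewrite (perm_mem pq) => /verticesP[z zq /= [zx zv]].
    have [] := sub_x0 z zq (etrans zx xx0); have := allP oq z zq => /=; lia.
  have : (x.1.2, x.2) \in vertices p by apply/verticesP; exists x => //; split=> //; right.
  rewrite (perm_mem pq) => /verticesP[z zq /= [zx zv]].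
  have [] := sub_x0 z zq (etrans zx xx0); have := allP oq z zq => /=; lia.
have pq0 := perm_to_rem x0q.
have size_rem_q : (size (rem x0 q) < n)%N by rewrite size_rem //; case: (q) x0q size_q.
have oq' : all (fun x => x.1.1 <= x.1.2)%N (rem x0 q) by apply/allP => x /mem_rem /(allP oq).
have nq' : nested (rem x0 q) by move=> x x' /mem_rem + /mem_rem; apply: nq.
have peel p' : all (fun x => x.1.1 <= x.1.2)%N p' -> perm_eq (vertices (x0 :: p')) (vertices q) ->
    (weight (unzip1 q) <= weight (unzip1 (x0 :: p')))%N /\
    ((weight (unzip1 (x0 :: p')) <= weight (unzip1 q))%N -> perm_eq (x0 :: p') q).
  move=> op' pp'; have pp'' : perm_eq (vertices p') (vertices (rem x0 q)).
    by move: (perm_trans pp' (vertices_perm pq0)); rewrite /= !perm_cons.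
  have [le_w eq_w] := IH p' (rem x0 q) size_rem_q op' oq' pp'' nq'.
  rewrite (wperm _ _ pq0) !wcons !leq_add2l; split=> //.
  move=> /eq_w pq'; rewrite perm_sym; apply: perm_trans pq0 _.
  by rewrite perm_cons perm_sym.
have [x0p|x0p] := boolP (x0 \in p).
  have pp := perm_to_rem x0p.
  have [||le_w eq_w] := peel (rem x0 p).
  - by apply/allP => x /mem_rem /(allP op).
  - by apply: perm_trans pq; rewrite perm_sym vertices_perm.
  rewrite (wperm _ _ pp); split=> // /eq_w.
  by apply: perm_trans.
(* z = (a, c) and w = (d, b) *)
have [z zp [z2 z1]] : exists2 z, z \in p & z.2 = x0.2 /\ z.1.1 = x0.1.1.
  have : (x0.1.1, x0.2) \in vertices p.
    by rewrite (perm_mem pq); apply/verticesP; exists x0 => //; split=> //; left.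
  move=> /verticesP[z zp /= [z2 zv]]; exists z => //; split=> //.
  by have [] := sub_p z zp z2; have := allP op z zp => /=; lia.
have [w wp [w2 w1]] : exists2 w, w \in p & w.2 = x0.2 /\ w.1.2 = x0.1.2.
  have : (x0.1.2, x0.2) \in vertices p.
    by rewrite (perm_mem pq); apply/verticesP; exists x0 => //; split=> //; right.
  move=> /verticesP[w wp /= [w2 wv]]; exists w => //; split=> //.
  by have [] := sub_p w wp w2; have := allP op w wp => /=; lia.
have zw : w != z.
  apply: contraNneq x0p => wz; rewrite wz in w1.
  by rewrite -(cedge_eq z x0).
have wp' : w \in rem z p.
  have : w \in z :: rem z p by rewrite -(perm_mem (perm_to_rem zp)).
  by rewrite inE (negbTE zw).
have ppzw : perm_eq p [:: z, w & rem w (rem z p)].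
  by apply: perm_trans (perm_to_rem zp) _; rewrite perm_cons perm_to_rem.
pose x1 : cedge := (orient (z.1.2, w.1.1), x0.2).
have [||le_w _] := peel (x1 :: rem w (rem z p)).
- rewrite /= leq_max geq_minl; apply/allP => x /mem_rem/mem_rem; exact: (allP op).
- apply: perm_trans pq; rewrite perm_sym; apply: perm_trans (vertices_perm ppzw) _.
  rewrite /vertices /= z1 z2 w1 w2 /x1 /orient /= /minn /maxn.
  case: ltnP => _; apply/seq.permP => P /=.
    by rewrite [LHS](AC (1*(1*(1*2))) (1*(4*(2*(3*5))))).
  by rewrite [LHS](AC (1*(1*(1*2))) (1*(4*(3*(2*5))))).
have lt_w : (weight (unzip1 [:: x0, x1 & rem w (rem z p)]) < weight (unzip1 p))%N.
  rewrite (wperm _ _ ppzw) !wcons !addnA ltn_add2r.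
  rewrite (_ : x1.1.1 * x1.1.2 = z.1.2 * w.1.1)%N; last first.
    by rewrite /x1 /orient /= /minn /maxn; case: ltnP => // _; rewrite mulnC.
  rewrite z1 w1.
  have [_ zb] := sub_p z zp z2; have [wa _] := sub_p w wp w2.
  have zb' : z.1.2 != x0.1.2.
    by apply: contraNneq x0p => e; rewrite -(cedge_eq z x0).
  have wa' : w.1.1 != x0.1.1.
    by apply: contraNneq x0p => e; rewrite -(cedge_eq w x0).
  move: (x0.1.1) (x0.1.2) (z.1.2) (w.1.1) zb wa zb' wa'; clear=> a b c d.
  by nia.
have lt_qp := leq_ltn_trans le_w lt_w.
by split; [apply: ltnW | rewrite leqNgt lt_qp].
Qed.

End NestedMinimality.

(** * Independence of the reduced monomials *)

Section Colorings.
Variables (T : eqType) (n : nat).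
Implicit Types (s : seq T) (q : seq (T * nat)).

(** The terms in the expansion of a product, over the edges, of sums over n
    colours. *)
Definition colorings s : seq (seq (T * nat)) :=
  foldr (fun e L => [seq (e, k) :: q | k <- iota 0 n, q <- L]) [:: [::]] s.

Lemma mem_colorings s q :
  (q \in colorings s) = (unzip1 q == s) && all (fun x => x.2 < n)%N q.
Proof.
elim: s q => [|e s IH] q /=; first by case: q.
apply/allpairsP/idP => [[[k q'] /= [kn q's ->]]|].
  by move: kn q's; rewrite IH mem_iota /= => kn /andP[/eqP-> ->]; rewrite kn eqxx.
case: q => // -[e' k] q /=; rewrite eqseq_cons => /andP[/andP[/eqP-> qs] /andP[kn qn]].
by exists (k, q); rewrite mem_iota /= kn IH qs qn.
Qed.

Lemma colorings_uniq s : uniq (colorings s).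
Proof.
elim: s => //= e s IH; apply: allpairs_uniq => //; first exact: iota_uniq.
by move=> [k q] [k' q'] _ _ [-> ->].
Qed.

Lemma prod_sum_colorings (R : comNzRingType) s (F : T * nat -> R) :
  \prod_(e <- s) \sum_(k <- iota 0 n) F (e, k) = \sum_(q <- colorings s) \prod_(x <- q) F x.
Proof.
elim: s => [|e s IH] /=; first by rewrite big_nil big_seq1 big_nil.
rewrite big_cons IH big_distrlr big_allpairs_dep /=.
by apply: eq_bigr => k _; apply: eq_bigr => q _; rewrite big_cons.
Qed.
End Colorings.

Lemma prod_count (R : comNzRingType) (X : eqType) (vs l : seq X) (t : X -> R) :
  uniq vs -> {subset l <= vs} ->
  \prod_(x <- l) t x = \prod_(v <- vs) t v ^+ count_mem v l.
Proof.
move=> uvs; elim: l => [|x l IH] sub.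
  by rewrite big_nil big1 // => v _; rewrite expr0.
rewrite big_cons IH; last by move=> y yl; apply: sub; rewrite inE yl orbT.
rewrite (bigD1_seq x) ?sub ?mem_head //= [RHS](bigD1_seq x) ?sub ?mem_head //=.
rewrite eqxx add1n exprS mulrA; congr (_ * _).
by apply: eq_bigr => v vx; rewrite eq_sym (negbTE vx) add0n.
Qed.

Section Independence.
Variable K : fieldType.
Hypothesis infK : infinite_set [set: K].
Local Notation edge := (nat * nat)%type.
Variables (n : nat) (d : nat -> K) (L : seq (seq edge)) (c : seq edge -> K).
Hypothesis d_neq0 : forall k, (k < n)%N -> d k != 0.
Hypothesis standardL : {in L, forall s, standard s}.
Hypothesis coverableL : {in L, forall s, coverable n s}.
Hypothesis uniqL : uniq L.
Hypothesis vanish : forall t : nat * nat -> K,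
  \sum_(s <- L) c s * \prod_(e <- s) \sum_(k <- iota 0 n) d k * (t (e.1, k) * t (e.2, k)) = 0.

(** Downward induction on the weight of s. In the expansion, the monomial of the
    colouring q0 of s into nests can only come from colourings of monomials at
    least as heavy as s; those that are heavier have coefficient 0 by induction,
    and those of the same weight have the same coloured edges as q0. *)
Lemma standard_monomials_independent : {in L, forall s, c s = 0}.
Proof.
pose Q := flatten [seq colorings n s | s <- L].
pose a (q : seq (edge * nat)) := c (unzip1 q) * \prod_(x <- q) d x.2.
pose vs := undup (flatten [seq vertices q | q <- Q]).
have sumQ (P : pred (seq (edge * nat))) (F : _ -> K) :
    \sum_(q <- Q | P q) c (unzip1 q) * F q
    = \sum_(s <- L) \sum_(q <- colorings n s | P q) c s * F q.
  rewrite big_flatten big_map; apply: eq_bigr => s _.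
  rewrite big_seq_cond [RHS]big_seq_cond; apply: eq_bigr => q /andP[].
  by rewrite mem_colorings => /andP[/eqP-> _].
have vanishQ t : \sum_(q <- Q) a q * \prod_(v <- vs) t v ^+ count_mem v (vertices q) = 0.
  rewrite -[RHS](vanish t).
  transitivity (\sum_(q <- Q) c (unzip1 q) *
      \prod_(x <- q) (d x.2 * (t (x.1.1, x.2) * t (x.1.2, x.2)))).
    apply: eq_big_seq => q qQ; rewrite /a -mulrA; congr (_ * _).
    rewrite big_split /= -prod_count ?undup_uniq //; last first.
      by move=> v vq; rewrite mem_undup; apply/flatten_mapP; exists q.
    congr (_ * _); rewrite /vertices big_flatten big_map; apply: eq_bigr => x _.
    by rewrite big_cons big_seq1.
  rewrite sumQ; apply: eq_bigr => s _; rewrite -big_distrr; congr (_ * _).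
  by rewrite -(prod_sum_colorings n s (fun x => d x.2 * (t (x.1.1, x.2) * t (x.1.2, x.2)))).
have wL s : s \in L -> (weight s <= \sum_(s <- L) weight s)%N.
  by move=> sL; rewrite (big_rem s) //= leq_addr.
move=> s; have [m] := ubnP (\sum_(s <- L) weight s - weight s).
elim: m s => // m IH s ms sL.
have c0 s' : s' \in L -> (weight s < weight s')%N -> c s' = 0.
  by move=> s'L lt; apply: IH => //; have := wL s' s'L; lia.
have [h [hn hlt]] := coverableL sL.
pose q0 := [seq (e, h e) | e <- s].
have q0s : unzip1 q0 = s by rewrite /q0 /unzip1 -map_comp map_id.
have q0Q : q0 \in colorings n s.
  by rewrite mem_colorings q0s eqxx all_map; apply/allP => e /hn.
have nq0 : nested q0.
  by move=> _ _ /mapP[e es ->] /mapP[e' e's ->] /=; apply: hlt.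
have oriented q s' : s' \in L -> unzip1 q = s' -> all (fun x : edge * nat => x.1.1 <= x.1.2)%N q.
  by move=> /standardL/andP[o _] e; move: o; rewrite -e all_map.
have in_vs s' q v : s' \in L -> q \in colorings n s' -> v \in vertices q -> v \in vs.
  move=> s'L qs' vq; rewrite mem_undup; apply/flatten_mapP; exists q => //.
  by apply/flatten_mapP; exists s'.
(* The colour of an edge in q0 is a function of the edge; so q, having the same
   coloured edges in the order of s, is q0 itself. *)
have only_q0 s' q : s' \in L -> q \in colorings n s' -> c s' != 0 ->
    all (fun v => count_mem v (vertices q) == count_mem v (vertices q0)) vs -> q = q0.
  move=> s'L qs' cs' /allP same; move: (qs'); rewrite mem_colorings => /andP[/eqP q_s' _].
  have vq : perm_eq (vertices q) (vertices q0).
    apply/allP => v; rewrite mem_cat => /orP[vq|vq0]; apply: same.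
      exact: (in_vs s' q).
    exact: (in_vs s q0).
  have [] := nested_minimal (oriented q s' s'L q_s') (oriented q0 s sL q0s) vq nq0.
  rewrite q_s' q0s leq_eqVlt => /orP[/eqP ww|lt]; last by rewrite c0 ?eqxx in cs'.
  rewrite ww => /(_ (leqnn _)) pq.
  have ss' : s' = s.
    apply: standard_inj (standardL s'L) (standardL sL) _.
    by rewrite -q_s' -q0s; apply: perm_map.
  rewrite /q0 -ss' -q_s' -map_comp -[LHS]map_id; apply/eq_in_map => -[e k].
  by rewrite (perm_mem pq) => /mapP[e' _ [-> ->]].
have := monomials_independent infK (fun v => count_mem v (vertices q0)) (undup_uniq _) vanishQ.
under eq_bigr => q _ do rewrite /a.
rewrite (sumQ _ (fun q => \prod_(x <- q) d x.2)) (bigD1_seq s) //=.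
rewrite [X in _ + X]big1_seq ?addr0 => [|s' /andP[s's s'L]]; last first.
  rewrite big_seq_cond big1 // => q /andP[qs' same].
  have [->|cs'] := eqVneq (c s') 0; first by rewrite mul0r.
  have qq0 := only_q0 s' q s'L qs' cs' same; move: qs'.
  by rewrite mem_colorings qq0 q0s eq_sym (negbTE s's).
have [//|cs] := eqVneq (c s) 0.
rewrite big_seq_cond (eq_bigl (pred1 q0)) => [|q /=]; last first.
  apply/andP/eqP => [[qs same]|->]; first exact: (only_q0 s q sL qs cs same).
  by split=> //; apply/allP => v _ /=.
rewrite -big_filter filter_pred1_uniq ?colorings_uniq // big_seq1.
move=> /eqP; rewrite mulf_eq0 (negbTE cs) /= => /eqP prod0.
have : \prod_(x <- q0) d x.2 != 0.
  rewrite prodf_seq_neq0; apply/allP => x xq0 /=; apply: d_neq0.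
  by move: q0Q; rewrite mem_colorings => /andP[_ /allP]; apply.
by rewrite prod0 eqxx.
Qed.

End Independence.

(** * Evaluation in the algebra of a form *)

Section WeakIdentities.
Variable K : fieldType.
Local Notation J := (free_jordan K).

Lemma jeval_comp (A : jordanType K) (w : nat -> A) (g : nat -> J) f :
  jeval w (jeval g f) = jeval (fun i => jeval w (g i)) f.
Proof.
apply: (@jeval_unique K A _ (fun f => jeval w (jeval g f))) => *.
- by rewrite jeval_var.
- by rewrite !jeval_one.
- by rewrite !jevalD.
- by rewrite !jevalZ.
- by rewrite !jevalM.
Qed.

Lemma jeval_subspace (A : jordanType K) (w : nat -> A) (W : set A) :
  is_subspace W -> is_subspace [set h | W (jeval w h)].
Proof.
move=> hW; split=> [|a u v hu hv]; first by rewrite /= jeval0; case: hW.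
by rewrite /= jevalD jevalZ; apply: hW.2.
Qed.

Lemma weak_consequence_identity (A : jordanType K) (W : set A) (F : set J) :
  is_subspace W -> (forall f, F f -> weak_identity W f) ->
  forall h, weak_consequence F h -> weak_identity W h.
Proof.
move=> hW hF h hh w hw; apply: (hh [set h | jeval w h = 0]); split.
  split; first apply: (jeval_subspace w (W := [set 0])).
    by split=> // a u v -> ->; rewrite scaler0 addr0.
  by move=> x y /= y0; rewrite jevalM y0 jmul0r.
move=> _ [f [g [Ff gX ->]]] /=; rewrite jeval_comp; apply: (hF f Ff) => i.
move: (g i) (gX i); apply: (lspan_ind (jeval_subspace w hW)) => _ [j _ <-].
by rewrite /= jeval_var.
Qed.

End WeakIdentities.

Section Form.
Variables (K : fieldType) (V : lmodType K) (form : {symmetric V}).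
Local Notation B := (form_algebra form).
Implicit Types (u v w y : V) (x : B).

Lemma formDl u v w : form (u + v) w = form u w + form v w.
Proof. exact: linearDl. Qed.
Lemma formZl (a : K) u w : form (a *: u) w = a * form u w.
Proof. exact: linearZl_LR. Qed.
Lemma formDr u v w : form w (u + v) = form w u + form w v.
Proof. by rewrite !(form_sym form w) formDl. Qed.
Lemma formZr (a : K) u w : form w (a *: u) = a * form w u.
Proof. by rewrite !(form_sym form w) formZl. Qed.
Lemma form0l w : form 0 w = 0.
Proof. exact: linear0l. Qed.
Lemma form_suml (T : Type) (r : seq T) (P : pred T) (F : T -> V) w :
  form (\sum_(i <- r | P i) F i) w = \sum_(i <- r | P i) form (F i) w.
Proof. by apply: (big_morph (form^~ w)) => [u v|]; rewrite ?formDl ?form0l. Qed.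
Lemma form_sumr (T : Type) (r : seq T) (P : pred T) (F : T -> V) w :
  form w (\sum_(i <- r | P i) F i) = \sum_(i <- r | P i) form w (F i).
Proof. by rewrite form_sym form_suml; under eq_bigr do rewrite form_sym. Qed.

Lemma form_jmulE (a b : K) u v :
  ((a, u) : B) ** ((b, v) : B) = (a * b + form u v, a *: v + b *: u).
Proof. by []. Qed.

Lemma vec_jmul u v : vec form u ** vec form v = (form u v, 0) :> B.
Proof. by rewrite form_jmulE mul0r add0r !scale0r addr0. Qed.

Lemma scalar_jmul (a b : K) u : ((a, 0) : B) ** ((b, u) : B) = (a * b, a *: u).
Proof. by rewrite form_jmulE form0l addr0 scaler0 addr0. Qed.

Lemma scalar_vec (a : K) u : ((a, 0) : B) ** vec form u = vec form (a *: u).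
Proof. by rewrite /vec scalar_jmul mulr0. Qed.

Lemma range_seq (w : nat -> B) : (forall i, range (vec form) (w i)) ->
  exists x : nat -> V, w = fun i => vec form (x i).
Proof.
by move=> hw; exists (fun i => (w i).2); apply/funext => i; have [u _ <-] := hw i.
Qed.

Lemma weak_identity_assoc : weak_identity (range (vec form)) (assoc_poly K).
Proof.
move=> w /range_seq[x ->] {w}.
rewrite /assoc_poly /jassociator jevalD -scaleN1r jevalZ scaleN1r !jevalM !jeval_var.
by rewrite !vec_jmul scalar_vec vec_jmul scalar_jmul formZl scaler0 subrr.
Qed.

(** Pairing the vector part with y turns the value of a monomial, be it a scalar
    or a vector, into a product of scalar products, where y is the vector that the
    letter 0 stands for. *)
Definition value (y : V) x : K := x.1 + form x.2 y.

Lemma value_linear y :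
  {morph value y : x z / x + z} /\
  forall (a : K) x, value y (a *: x) = a * value y x.
Proof.
split=> [[a u] [b v]|a [b u]]; rewrite /value /=; first by rewrite formDl addrACA.
by rewrite formZl mulrDr.
Qed.

Lemma value_scalar y (a : K) x : value y (((a, 0) : B) ** x) = a * value y x.
Proof. by case: x => b u; rewrite scalar_jmul /value /= formZl mulrDr. Qed.

Lemma jeval_pairing (v : nat -> V) e : proper_edge e ->
  jeval (fun i => vec form (v i.+1)) (pairing K e) = (form (v e.1) (v e.2), 0).
Proof. by case: e => -[|i] [|j] //= _; rewrite /pairing jevalM !jeval_var vec_jmul. Qed.

Lemma jeval_proper (v : nat -> V) s : all proper_edge s ->
  jeval (fun i => vec form (v i.+1)) (mono K s) = (\prod_(e <- s) form (v e.1) (v e.2), 0).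
Proof.
elim: s => [|e s IH] /=; first by rewrite jeval_one big_nil.
case/andP=> pe ps; rewrite /mono /= jevalM jeval_pairing // -/(mono K s) IH //.
by rewrite scalar_jmul scaler0 big_cons.
Qed.

Lemma value_mono (v : nat -> V) s : valid s ->
  value (v 0%N) (jeval (fun i => vec form (v i.+1)) (mono K s))
  = \prod_(e <- s) form (v e.1) (v e.2).
Proof.
elim: s => [|e s IH] vs.
  by rewrite jeval_one big_nil /value /= form0l addr0.
rewrite /mono /= jevalM -/(mono K s) big_cons.
have [pe|npe] := boolP (proper_edge e).
  by rewrite jeval_pairing // value_scalar IH // (valid_cons vs).
have ps : all proper_edge s.
  by apply/allP => e' es; have := valid_proper vs es; rewrite (negbTE npe).
rewrite jeval_proper //; case/andP: vs => /andP[]; case: e npe => -[|i] [|j] //= _ _ _ _.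
rewrite /pairing /= jmul1l jeval_var jmulC scalar_jmul mulr0 /value add0r formZl.
by rewrite mulrC form_sym.
Qed.

End Form.

Section Orthogonal.
Variables (K : fieldType) (V : lmodType K) (form : {symmetric V}).
Hypothesis char2 : 2%N \notin [pchar K].
Hypothesis nondeg : nondegenerate_form form.
Implicit Types (u v w : V) (e : seq V).

Definition orthogonal_seq e := uniq e /\ {in e &, forall u v, (form u v == 0) = (u != v)}.

(** Were all vectors orthogonal to e isotropic, the form would vanish on the
    orthogonal complement of e, by polarization, and so this complement would be in
    the radical. *)
Lemma orthogonal_extend e : orthogonal_seq e ->
  lspan [set v | v \in e] <> setT ->
  exists w, form w w != 0 /\ {in e, forall v, form v w = 0}.
Proof.
move=> [ue oe] span; apply: contrapT => none; apply: span; apply/seteqP; split=> // x _.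
have iso w : {in e, forall v, form v w = 0} -> form w w = 0.
  move=> ew; apply/eqP; apply: contrapT => /negP ww; by apply: none; exists w.
pose par x := \sum_(v <- e) (form v x / form v v) *: v.
have perp z : {in e, forall v, form v (z - par z) = 0}.
  move=> v ve; rewrite -scaleN1r formDr formZr mulN1r /par form_sumr (bigD1_seq v) //=.
  rewrite formZr divfK ?oe // ?eqxx // big1_seq ?addr0 ?subrr // => u /andP[uv eu].
  have /eqP vu0 : form v u == 0 by rewrite oe // eq_sym.
  by rewrite formZr vu0 mulr0.
have perp2 z : form (x - par x) (z - par z) = 0.
  have double0 (a : K) : a + a = 0 -> a = 0 := @lmod_double_eq0 K K^o a char2.
  apply: double0.
  have xz_perp : {in e, forall v, form v (x - par x + (z - par z)) = 0}.
    by move=> v ve; rewrite formDr !perp // addr0.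
  move: (iso _ (perp x)) (iso _ (perp z)) (iso _ xz_perp).
  move: (x - par x) (z - par z) => p q; rewrite formDl !formDr => -> ->.
  by rewrite add0r addr0 (form_sym form q).
have x_par : x - par x = 0.
  apply: nondeg => z; rewrite -(subrK (par z) z) formDr perp2 add0r form_sumr.
  by rewrite big1_seq // => v /= ve; rewrite formZr form_sym perp // mulr0.
rewrite -(subrK (par x) x) x_par add0r.
have hS := lspan_subspace [set v | v \in e].
rewrite /par big_seq; apply: (subspace_sum _ hS) => v ve.
by apply: (subspaceZ _ hS); apply: sub_lspan.
Qed.

Lemma orthogonal_exists n :
  (forall e, (size e < n)%N -> lspan [set v | v \in e] <> setT) ->
  exists2 e, orthogonal_seq e & size e = n.
Proof.
elim: n => [|n IH] span; first by exists [::].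
have [e oe size_e] : exists2 e, orthogonal_seq e & size e = n.
  by apply: IH => e en; apply: span; apply: ltnW.
have [|w [ww ew]] := orthogonal_extend oe; first by apply: span; rewrite size_e.
exists (w :: e); last by rewrite /= size_e.
have we : w \notin e by apply: contra ww => we; rewrite ew.
case: oe => ue oe; split; first by rewrite /= we.
have we' v : v \in e -> w == v = false by move=> ve; apply: contraNF we => /eqP->.
move=> u v; rewrite !inE => /predU1P[->|ue'] /predU1P[->|ve].
- by rewrite eqxx (negbTE ww).
- by rewrite form_sym ew // we' // eqxx.
- by rewrite ew // eq_sym we' // eqxx.
- exact: oe.
Qed.

End Orthogonal.

Lemma finite_dim_span (K : fieldType) (V : vectType K) (e : seq V) :
  (size e < \dim {:V})%N -> lspan [set v | v \in e] <> setT.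
Proof.
move=> size_e e_span; have : (fullv <= <<e>>)%VS.
  apply/subvP => v _; have : lspan [set v | v \in e] v by rewrite e_span.
  move: v; apply: (lspan_ind (S := [set v | v \in <<e>>%VS])).
    by split=> [|a u v /= hu hv]; rewrite /= ?mem0v // memvD // memvZ.
  by move=> v /= ve; apply: memv_span.
move/dimvS; rewrite leqNgt => /negP; apply.
exact: leq_ltn_trans (dim_span e) size_e.
Qed.

Section Alternating.
Variables (K : fieldType) (n : nat) (V : vectType K) (form : {symmetric V}).
Hypothesis dimV : \dim {:V} = n.
Hypothesis nondeg : nondegenerate_form form.

(** The matrix factors through the space of coordinates, of dimension n. *)
Lemma gram_det0 (x y : 'I_n.+1 -> V) : \det (\matrix_(i, j) form (x i) (y j)) = 0.
Proof.
pose b := vbasis {:V}.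
pose A : 'M[K]_(n.+1, \dim {:V}) := \matrix_(i, k) form (x i) b`_k.
pose C : 'M[K]_(\dim {:V}, n.+1) := \matrix_(k, j) coord b k (y j).
have -> : \matrix_(i, j) form (x i) (y j) = A *m C.
  apply/matrixP => i j; rewrite !mxE {1}(coord_vbasis (memvf (y j))) form_sumr.
  by apply: eq_bigr => k _; rewrite !mxE formZr mulrC.
apply/eqP; apply: contraTT (ltnSn n); rewrite -unitfE -unitmxE => unitAC.
rewrite -leqNgt -[leqLHS](mxrank_unit unitAC); apply: leq_trans (mxrankM_maxl _ _) _.
by apply: leq_trans (rank_leq_col _) _; rewrite dimV.
Qed.

(** The scalar product with y of the value of the alternating polynomial is a Gram
    determinant of size n+1, whose first row belongs to y. *)
Lemma weak_identity_alt : weak_identity (range (vec form)) (alt_poly K n).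
Proof.
move=> w /range_seq[x ->] {w}.
rewrite jeval_alt_poly.
have term (sigma : 'S_n.+1) :
    foldl (fun p (k : 'I_n) => p ** (vec form (x (n.+1 + k)%N) ** vec form (x (sigma (lift ord0 k)))))
      (vec form (x (sigma ord0))) (enum 'I_n)
    = vec form ((\prod_(k < n) form (x (n.+1 + k)%N) (x (sigma (lift ord0 k)))) *: x (sigma ord0)).
  rewrite -[index_enum _]enumT.
  elim: (enum 'I_n) (x (sigma ord0)) => [|k l IH] z /=; first by rewrite big_nil scale1r.
  rewrite vec_jmul jmulC scalar_vec.
  by rewrite IH big_cons scalerA mulrC.
under eq_bigr => sigma _ do rewrite term.
have vecZ (a : K) u : a *: vec form u = vec form (a *: u).
  by rewrite -scalar_vec form_jmulE form0l mulr0 addr0 scaler0 addr0 -{1}(mulr0 a).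
have vecD u v : vec form (u + v) = vec form u + vec form v.
  by rewrite -[RHS]/(0 + 0, u + v) addr0.
under eq_bigr do rewrite vecZ; rewrite -(big_morph (vec form) vecD (erefl _)).
rewrite (_ : \sum_(_ | _) _ = 0) //; apply: nondeg => y; rewrite form_suml.
pose X (i : 'I_n.+1) := if unlift ord0 i is Some k then x (n.+1 + k)%N else y.
rewrite -[RHS](gram_det0 X (fun j => x j)); apply: eq_bigr => sigma _.
rewrite !formZl big_ord_recl !mxE /X unlift_none form_sym [X in _ * X]mulrC.
congr (_ * (_ * _)); apply: eq_bigr => k _; rewrite !mxE.
by rewrite liftK.
Qed.

End Alternating.

(** * Weak identities are consequences *)

Section Assembly.
Variable K : fieldType.
Local Notation J := (free_jordan K).
Hypothesis infK : infinite_set [set: K].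
Hypothesis char2 : 2%N \notin [pchar K].

Lemma weak_consequence_vars (F : set J) (f : J) (g : nat -> nat) :
  F f -> weak_consequence F (jeval (fun i => jvar (g i)) f).
Proof.
move=> Ff S [_ hS]; apply: hS; exists f, (fun i => jvar (g i)); split=> // i.
by apply: sub_lspan; exists (g i).
Qed.

Lemma weak_consequence_assoc (F : set J) i j k l : F (assoc_poly K) ->
  weak_consequence F (jassociator (jvar i ** jvar j) (jvar k) (jvar l)).
Proof.
move=> FA; have := @weak_consequence_vars F _ (nth 0%N [:: i; j; k; l]) FA.
rewrite /assoc_poly /jassociator jevalD -scaleN1r jevalZ scaleN1r.
by rewrite !jevalM !jeval_var.
Qed.

(** As the ideal consists of weak identities, the normal form of a weak identity
    vanishes too; evaluated on the span of e, this is the relation of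
    [standard_monomials_independent]. *)
Lemma weak_identity_consequence (V : lmodType K) (form : {symmetric V}) (F : set J)
    (e : seq V) (L : seq (seq (nat * nat))) (c : seq (nat * nat) -> K) (f : J) :
  orthogonal_seq form e ->
  (forall h, weak_consequence F h -> weak_identity (range (vec form)) h) ->
  uniq L ->
  {in L, forall s, [/\ valid s, standard s & coverable (size e) s]} ->
  congm (weak_consequence F) f (\sum_(s <- L) c s *: mono K s) ->
  weak_identity (range (vec form)) f -> weak_consequence F f.
Proof.
move=> [ue oe] FI uL PL fL f0.
suff cL : {in L, forall s, c s = 0}.
  suff sum0 : \sum_(s <- L) c s *: mono K s = 0 by rewrite -(subr0 f) -sum0.
  by apply: big1_seq => s /= sL; rewrite cL // scale0r.
pose d k := form e`_k e`_k.
apply: (@standard_monomials_independent K infK (size e) d) => //.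
- by move=> k ke; rewrite /d oe ?mem_nth // negbK.
- by move=> s /PL[].
- by move=> s /PL[].
move=> t; pose v i := \sum_(k < size e) t (i, k : nat) *: e`_k.
pose w i := vec form (v i.+1).
have wV i : range (vec form) (w i) by exists (v i.+1).
have := FI _ fL w wV; rewrite jevalD -scaleN1r jevalZ f0 // add0r scaleN1r.
move=> /eqP; rewrite oppr_eq0 => /eqP sum0.
have [vD vZ] := value_linear form (v 0%N).
have v0 : value (v 0%N) (0 : form_algebra form) = 0 by rewrite /value form0l addr0.
have := congr1 (value (v 0%N)) sum0.
rewrite v0 (big_morph _ (jevalD w) (jeval0 w)) (big_morph _ vD v0) => E.
rewrite -[RHS]E; apply: eq_big_seq => s /PL[vs _ _]; rewrite jevalZ vZ value_mono //.
congr (_ * _); apply: eq_bigr => -[i j] _ /=.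
have -> : iota 0 (size e) = index_iota 0 (size e) by rewrite /index_iota subn0.
rewrite big_mkord.
rewrite /v form_suml; apply: eq_bigr => k _; rewrite formZl form_sumr (bigD1 k) //=.
rewrite big1 ?addr0 ?formZr => [|l lk].
  by rewrite /d [RHS]mulrA [RHS]mulrC.
rewrite formZr; have /eqP-> : form e`_k e`_l == 0; last by rewrite mulr0.
by rewrite oe ?mem_nth // nth_uniq // eq_sym.
Qed.

End Assembly.

Theorem theorem20 (K : fieldType)
    (infK : infinite_set [set: K]%classic) (char2 : 2%N \notin [pchar K]) :
  (forall (V : lmodType K) (form : {symmetric V}),
     infinite_dim V -> nondegenerate_form form ->
     forall f : free_jordan K,
       weak_identity (range (vec form)) f ->
       weak_consequence [set assoc_poly K] f) /\
  (forall (n : nat) (Vn : vectType K) (form : {symmetric Vn}),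
     (1 <= n)%N -> \dim {: Vn} = n -> nondegenerate_form form ->
     forall f : free_jordan K,
       weak_identity (range (vec form)) f ->
       weak_consequence [set assoc_poly K; alt_poly K n] f).
Proof.
have idI F : is_ideal (@weak_consequence K F) by apply: ideal_gen_ideal.
split=> [V form infV nondeg f f0|n V form _ dimV nondeg f f0].
  pose F : set (free_jordan K) := [set assoc_poly K].
  have FA i j k l := weak_consequence_assoc i j k l (erefl : F (assoc_poly K)).
  have [L [c [uL PL fL]]] := mono_span_sum (idI F) (mono_span_standard char2 (idI F) FA f).
  pose N := \max_(s <- L) size s.
  have [e oe size_e] : exists2 e, orthogonal_seq form e & size e = N.
    by apply: orthogonal_exists => // e _; apply: infV.
  apply: (weak_identity_consequence infK oe _ uL _ fL f0).
    apply: weak_consequence_identity; first exact: vec_subspace.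
    by move=> _ ->; apply: weak_identity_assoc.
  move=> s sL; have [vs ss] := PL s sL; split=> //.
  by apply: coverable_size; rewrite size_e; apply: leq_bigmax_seq.
pose F : set (free_jordan K) := [set assoc_poly K; alt_poly K n].
have FA i j k l := weak_consequence_assoc i j k l (or_introl erefl : F (assoc_poly K)).
have FB g := weak_consequence_vars g (or_intror erefl : F (alt_poly K n)).
have [L [c [uL PL fL]]] := mono_span_sum (idI F) (mono_span_coverable char2 (idI F) FA FB f).
have [e oe size_e] : exists2 e, orthogonal_seq form e & size e = n.
  by apply: orthogonal_exists => // e en; apply: finite_dim_span; rewrite dimV.
apply: (weak_identity_consequence infK oe _ uL _ fL f0); last by rewrite size_e.
apply: weak_consequence_identity; first exact: vec_subspace.
by move=> _ [->|->]; [apply: weak_identity_assoc | apply: weak_identity_alt].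
Qed.
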